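(* \textsc{Token Sliding Optimization} restricted to instances whose graph is $2$-degenerate, parameterized by $\ell$, is W[1]-hard.
   Context: A graph is $2$-degenerate if every induced subgraph has a vertex of degree at most $2$. An instance of \textsc{Token Sliding Optimization} is $(G,S,T,k,\ell)$ where $G$ is a simple undirected graph, $S,T$ are independent sets of size $k\ge1$, and $\ell\ge1$; it is a yes-instance iff there is a sequence $S=I_0,\dots,I_{\ell'}=T$, $\ell'\le\ell$, of independent sets of size $k$ such that each $I_{j+1}=(I_j\setminus\{u\})\cup\{v\}$ for some $u\in I_j$, $v\notin I_j$ with $\{u,v\}\in E(G)$. *)

(* Defs.v *)
From mathcomp Require Import all_boot.
Set Implicit Arguments. Unset Strict Implicit. Unset Printing Implicit Defensive.

Inductive sym := S0 | S1 | SB.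
Inductive move := ML | MR | MN.

Record TM := mkTM {
  tm_state : finType;
  tm_start : tm_state;
  tm_halt  : tm_state -> bool;
  tm_delta : tm_state -> sym -> tm_state * sym * move }.

(* tape = (cells left of head, nearest first ; head cell ; cells right of head) *)
Definition tape := (seq sym * sym * seq sym)%type.
Definition config (M : TM) := (tm_state M * tape)%type.

Definition tm_step (M : TM) (c : config M) : config M :=
  let: (q, (l, h, r)) := c in
  if tm_halt q then c else
  let: (q', w, m) := tm_delta q h in
  match m with
  | ML => match l with
          | [::] => (q', ([::], SB, w :: r))
          | a :: l' => (q', (l', a, w :: r)) end
  | MR => match r with
          | [::] => (q', (w :: l, SB, [::]))
          | a :: r' => (q', (w :: l, a, r')) end
  | MN => (q', (l, w, r))
  end.

Definition bsym (b : bool) : sym := if b then S1 else S0.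

Definition tm_init (M : TM) (x : seq bool) : config M :=
  match x with
  | [::] => (tm_start M, ([::], SB, [::]))
  | b :: x' => (tm_start M, ([::], bsym b, map bsym x'))
  end.

Fixpoint readbits (s : seq sym) : seq bool :=
  match s with
  | S0 :: s' => false :: readbits s'
  | S1 :: s' => true :: readbits s'
  | _ => [::]
  end.

Definition tm_output (M : TM) (c : config M) : seq bool :=
  let: (_, (_, h, r)) := c in readbits (h :: r).

Definition computes_within (M : TM) (x y : seq bool) (t : nat) : Prop :=
  exists i, i <= t /\
    let c := iter i (@tm_step M) (tm_init M x) in
    tm_halt c.1 /\ tm_output c = y.

Definition unary (k : nat) : seq bool := nseq k true ++ [:: false].

Definition computable (f : nat -> nat) : Prop :=
  exists M : TM, forall k, exists t, computes_within M (nseq k true) (nseq (f k) true) t.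

Definition simple_graph (n : nat) (adj : rel 'I_n) : Prop :=
  (forall u v, adj u v = adj v u) /\ (forall u, ~~ adj u u).

Definition enc_graph (n : nat) (adj : rel 'I_n) : seq bool :=
  unary n ++ [seq adj i j | i <- enum 'I_n, j <- enum 'I_n].

Definition enc_set (n : nat) (A : {set 'I_n}) : seq bool :=
  [seq (i \in A) | i <- enum 'I_n].

Definition independent (n : nat) (adj : rel 'I_n) (A : {set 'I_n}) : bool :=
  [forall u in A, forall v in A, ~~ adj u v].

Definition two_degenerate (n : nat) (adj : rel 'I_n) : Prop :=
  forall X : {set 'I_n}, X != set0 ->
    exists2 v, v \in X & #|[set w in X | adj v w]| <= 2.

(* Clique (parameterized by k), the canonical W[1]-complete problem    *)

Record clique_inst := CliqueInst {
  cq_n : nat; cq_adj : rel 'I_cq_n; cq_k : nat }.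

Definition enc_clique (I : clique_inst) : seq bool :=
  enc_graph (@cq_adj I) ++ unary (cq_k I).

Definition clique_yes (I : clique_inst) : Prop :=
  exists K : {set 'I_(cq_n I)}, #|K| = cq_k I /\
    (forall u v, u \in K -> v \in K -> u != v -> @cq_adj I u v).

Record tso_inst := TSOInst {
  ts_n : nat; ts_adj : rel 'I_ts_n;
  ts_S : {set 'I_ts_n}; ts_T : {set 'I_ts_n};
  ts_k : nat; ts_l : nat }.

Definition enc_tso (J : tso_inst) : seq bool :=
  enc_graph (@ts_adj J) ++ enc_set (@ts_S J) ++ enc_set (@ts_T J)
  ++ unary (ts_k J) ++ unary (ts_l J).

Definition tso_valid (J : tso_inst) : Prop :=
  simple_graph (@ts_adj J) /\
  independent (@ts_adj J) (@ts_S J) /\ independent (@ts_adj J) (@ts_T J) /\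
  #|ts_S J| = ts_k J /\ #|ts_T J| = ts_k J /\ 1 <= ts_k J /\ 1 <= ts_l J.

Definition slide (n : nat) (adj : rel 'I_n) (I J : {set 'I_n}) : bool :=
  [exists u, exists v,
     [&& u \in I, v \notin I, adj u v & J == (I :\ u) :|: [set v]]].

Definition tso_yes (J : tso_inst) : Prop :=
  exists s : seq {set 'I_(ts_n J)},
    [/\ path (slide (@ts_adj J)) (@ts_S J) s,
        last (@ts_S J) s = ts_T J,
        size s <= ts_l J &
        all (fun I => independent (@ts_adj J) I && (#|I| == ts_k J)) (ts_S J :: s)].

(* an FPT reduction from Clique (parameter k).                         *)

Definition W1_hard_TSO_2degenerate_param_l : Prop :=
  exists (M : TM) (f g : nat -> nat) (c : nat),
    computable f /\ computable g /\
    forall I : clique_inst, simple_graph (@cq_adj I) ->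
      exists J : tso_inst,
        [/\ computes_within M (enc_clique I) (enc_tso J)
              (f (cq_k I) * (size (enc_clique I)).+1 ^ c),
            tso_valid J,
            two_degenerate (@ts_adj J),
            ts_l J <= g (cq_k I) &
            (clique_yes I <-> tso_yes J)].

(* Main.v *)
(** Reduction from Clique, after adding a universal vertex, so that a clique of size
    [K = k + 1] is sought among [w = n + 1] vertices. A selection token sits on a vertex
    [X(i,u)] for every colour [i < K] and vertex [u < w]; moving it aside and back
    costs two slides. For every pair [(i,j)] a token has to travel from [A(i,j)] to
    [B(i,j)] along one of the paths A - S - P - T - B, one per pair [(u,v)] that is an
    edge of the graph (or [u = v] if [i = j]), whose middle vertex P is adjacent to
    [X(i,u)] and [X(j,v)]. The budget [4 K^2 + 2 K] pays for the [K^2] walks and for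
    moving aside only [K] selection tokens; as every pair [(i,i)] needs one of
    colour [i], exactly one vertex per colour is selected, and these form a clique. A
    potential (the height along the paths) makes this accounting immune to tokens
    that change paths through X. S and T have two neighbours, and P has only two once
    they are removed, so the graph is 2-degenerate.

    The reduction is computed by structured programs acting on the tape, compiled to
    Turing machines. Left of the input the tape is divided into 16 interleaved tracks, each
    holding a register in unary or a bit array, so that the bit with index given by a
    register is found by walking along that register. Nested bounded loops
    over such registers print the output; a running time [(B + 2)^e], with [B] bounding
    all registers and lengths, is stable under sequencing and looping. *)
Require Import Defs.
From Stdlib Require Import FunctionalExtensionality.
From mathcomp Require Import all_boot ssralg ssrint zify.
Set Implicit Arguments. Unset Strict Implicit. Unset Printing Implicit Defensive.

(** * Structured tape programs and their Turing machines *)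

Definition itape := int -> sym.

Definition upd (T : itape) (p : int) (w : sym) : itape :=
  fun x => if x == p then w else T x.

(** Defined by cases on the constructors, not as a subtraction, so that moves on concrete positions
    reduce by computation. *)
Definition left (p : int) : int :=
  match p with Posz 0 => Negz 0 | Posz n.+1 => Posz n | Negz n => Negz n.+1 end.

Definition right (p : int) : int :=
  match p with Posz n => Posz n.+1 | Negz 0 => Posz 0 | Negz n.+1 => Negz n end.

Definition mv (m : move) (p : int) : int :=
  match m with ML => left p | MR => right p | MN => p end.

Lemma leftK : cancel left right.
Proof. by case=> [[|n]|n]. Qed.

Lemma rightK : cancel right left.
Proof. by case=> [n|[|n]]. Qed.

Lemma upd_same T p : upd T p (T p) = T.
Proof. by apply: functional_extensionality => x; rewrite /upd; case: eqP => // ->. Qed.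

Lemma iter_left_neq i p : (iter i.+1 left p == p) = false.
Proof.
have E1 q : left q = (q - 1)%R by case: q => [[|a]|a] /=; lia.
have E : iter i.+1 left p = (p - i.+1%:Z)%R.
  by elim: i.+1 => [|j IH]; rewrite ?iterS ?E1 ?IH /=; lia.
by rewrite E; apply/eqP; lia.
Qed.

Lemma iter_right_neq i p : (iter i.+1 right p == p) = false.
Proof.
have C : iter i.+1 left (iter i.+1 right p) = p.
  elim: i.+1 p => // j IH q; rewrite iterSr iterS rightK; exact: IH.
by rewrite -{2}C eq_sym iter_left_neq.
Qed.

Inductive prog :=
  | Act of (sym -> sym) & move
  | Seq of prog & prog
  | If of pred sym & prog & prog
  | While of pred sym & prog.

(** The last index is the exact number of machine steps after compilation: each test costs one step,
    sequencing costs nothing. *)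
Inductive ex : prog -> itape -> int -> itape -> int -> nat -> Prop :=
  | ex_act w m T p : ex (Act w m) T p (upd T p (w (T p))) (mv m p) 1
  | ex_seq c1 c2 T1 p1 T2 p2 T3 p3 t1 t2 :
      ex c1 T1 p1 T2 p2 t1 -> ex c2 T2 p2 T3 p3 t2 ->
      ex (Seq c1 c2) T1 p1 T3 p3 (t1 + t2)
  | ex_ifT (b : pred sym) c1 c2 T p T' p' t : b (T p) -> ex c1 T p T' p' t ->
      ex (If b c1 c2) T p T' p' t.+1
  | ex_ifF (b : pred sym) c1 c2 T p T' p' t : ~~ b (T p) -> ex c2 T p T' p' t ->
      ex (If b c1 c2) T p T' p' t.+1
  | ex_whF (b : pred sym) c T p : ~~ b (T p) -> ex (While b c) T p T p 1
  | ex_whT (b : pred sym) c T p T1 p1 T2 p2 t1 t2 : b (T p) -> ex c T p T1 p1 t1 ->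
      ex (While b c) T1 p1 T2 p2 t2 -> ex (While b c) T p T2 p2 (t1 + t2).+1.

Record mach := Mach {
  St : finType;
  st0 : St;
  dl : St -> sym -> option St * sym * move }.

(** The exit of the first machine is redirected to the entry of the second within the same step, so
    no time is lost in between. *)
Definition mach_seq (M1 M2 : mach) : mach :=
  @Mach (St M1 + St M2)%type (inl (st0 M1)) (fun q s =>
    match q with
    | inl q1 => let: (o, w, m) := dl q1 s in
        (Some (if o is Some q1' then inl q1' else inr (st0 M2)), w, m)
    | inr q2 => let: (o, w, m) := dl q2 s in (omap inr o, w, m)
    end).

Definition mach_if (b : pred sym) (M1 M2 : mach) : mach :=
  @Mach (option (St M1 + St M2))%type None (fun q s =>
    match q with
    | None => (Some (Some (if b s then inl (st0 M1) else inr (st0 M2))), s, MN)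
    | Some (inl q1) => let: (o, w, m) := dl q1 s in (omap (Some \o inl) o, w, m)
    | Some (inr q2) => let: (o, w, m) := dl q2 s in (omap (Some \o inr) o, w, m)
    end).

Definition mach_while (b : pred sym) (M : mach) : mach :=
  @Mach (option (St M)) None (fun q s =>
    match q with
    | None => (if b s then Some (Some (st0 M)) else None, s, MN)
    | Some q1 => let: (o, w, m) := dl q1 s in (Some o, w, m)
    end).

Fixpoint compile (c : prog) : mach :=
  match c with
  | Act w m => @Mach unit tt (fun _ s => (None, w s, m))
  | Seq c1 c2 => mach_seq (compile c1) (compile c2)
  | If b c1 c2 => mach_if b (compile c1) (compile c2)
  | While b c => mach_while b (compile c)
  end.

(* The state [None] is the exit of the machine: no run continues from it. *)
Inductive mrun (M : mach) :
    option (St M) -> itape -> int -> option (St M) -> itape -> int -> nat -> Prop :=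
  | mrun0 o T p : mrun o T p o T p 0
  | mrunS q T p o w m o' T' p' t : dl q (T p) = (o, w, m) ->
      mrun o (upd T p w) (mv m p) o' T' p' t -> mrun (Some q) T p o' T' p' t.+1.

Lemma mrun_trans (M : mach) (o1 o2 o3 : option (St M)) T1 p1 T2 p2 T3 p3 t1 t2 :
  mrun o1 T1 p1 o2 T2 p2 t1 -> mrun o2 T2 p2 o3 T3 p3 t2 ->
  mrun o1 T1 p1 o3 T3 p3 (t1 + t2).
Proof. by elim=> // q T p o w m o' T' p' t e _ IH /IH; apply: mrunS e. Qed.

(** The value [f None] is left free: it is the exit for a branch, the entry of the next machine for
    a sequence, and the loop head for a loop body. *)
Lemma mrun_embed (M1 M2 : mach) (f : option (St M1) -> option (St M2)) :
  (forall q, exists2 q2, f (Some q) = Some q2 &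
     forall s, dl q2 s = let: (o, w, m) := dl q s in (f o, w, m)) ->
  forall o T p o' T' p' t, mrun o T p o' T' p' t -> mrun (f o) T p (f o') T' p' t.
Proof.
move=> H o T p o' T' p' t; elim=> [*|q {}T {}p {}o w m {}o' {}T' {}p' {}t e _ IH].
  exact: mrun0.
by have [q2 -> E] := H q; apply: mrunS IH; rewrite E e.
Qed.

Lemma mrun_test (M : mach) (q : St M) o T p :
  dl q (T p) = (o, T p, MN) -> mrun (Some q) T p o T p 1.
Proof. by move=> e; apply: mrunS e _; rewrite upd_same; apply: mrun0. Qed.

Lemma compile_correct c T p T' p' t :
  ex c T p T' p' t -> mrun (Some (st0 (compile c))) T p None T' p' t.
Proof.
elim=> {c T p T' p' t}.
- by move=> w m T p; apply: (mrunS (o := None)) => //; apply: mrun0.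
- move=> c1 c2 T1 p1 T2 p2 T3 p3 t1 t2 _ H1 _ H2.
  pose f1 (o : option (St (compile c1))) : option (St (compile (Seq c1 c2))) :=
    Some (if o is Some q then inl q else inr (st0 (compile c2))).
  pose f2 (o : option (St (compile c2))) : option (St (compile (Seq c1 c2))) := omap inr o.
  apply: (mrun_trans (o2 := f1 None)); first by apply: (mrun_embed (f := f1)) H1 => q; exists (inl q).
  by apply: (mrun_embed (f := f2)) H2 => q; exists (inr q).
- move=> b c1 c2 T p T' p' t bT _ H; rewrite -add1n.
  pose f (o : option (St (compile c1))) : option (St (compile (If b c1 c2))) :=
    omap (Some \o inl) o.
  apply: (mrun_trans (o2 := f (Some (st0 (compile c1))))).
    by apply: mrun_test; rewrite /= bT.
  by apply: (mrun_embed (f := f)) H => q; exists (Some (inl q)).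
- move=> b c1 c2 T p T' p' t bT _ H; rewrite -add1n.
  pose f (o : option (St (compile c2))) : option (St (compile (If b c1 c2))) :=
    omap (Some \o inr) o.
  apply: (mrun_trans (o2 := f (Some (st0 (compile c2))))).
    by apply: mrun_test; rewrite /= (negPf bT).
  by apply: (mrun_embed (f := f)) H => q; exists (Some (inr q)).
- by move=> b c T p bT; apply: mrun_test; rewrite /= (negPf bT).
- move=> b c T p T1 p1 T2 p2 t1 t2 bT _ H1 _ H2; rewrite -addSn -add1n.
  pose f (o : option (St (compile c))) : option (St (compile (While b c))) := Some o.
  apply: mrun_trans H2; apply: (mrun_trans (o2 := f (Some (st0 (compile c))))).
    by apply: mrun_test; rewrite /= bT.
  by apply: (mrun_embed (f := f)) H1 => q; exists (Some q).
Qed.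

(** * Simulation on the two-list tape of Turing machines *)

Definition tm_of (M : mach) : TM :=
  @mkTM (option (St M)) (Some (st0 M)) (fun o => ~~ isSome o)
    (fun o s => if o is Some q then dl q s else (None, s, MN)).

(** Cells beyond the end of a list are read as the default [SB], so lists that differ only in
    trailing blanks represent the same tape. *)
Definition rep (T : itape) (p : int) (tp : tape) : Prop :=
  let: (l, h, r) := tp in
  [/\ h = T p, forall i, nth SB l i = T (iter i.+1 left p) &
      forall i, nth SB r i = T (iter i.+1 right p)].

Lemma rep_step T p l h r w m : rep T p (l, h, r) ->
  rep (upd T p w) (mv m p)
    match m with
    | ML => if l is a :: l' then (l', a, w :: r) else ([::], SB, w :: r)
    | MR => if r is a :: r' then (w :: l, a, r') else (w :: l, SB, [::])
    | MN => (l, w, r)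
    end.
Proof.
case=> hE lE rE.
have uL i : upd T p w (iter i left (left p)) = T (iter i.+1 left p).
  by rewrite -iterSr /upd iter_left_neq.
have uR i : upd T p w (iter i right (right p)) = T (iter i.+1 right p).
  by rewrite -iterSr /upd iter_right_neq.
have uw : upd T p w p = w by rewrite /upd eqxx.
case: m => /=.
- have R i : nth SB (w :: r) i = upd T p w (iter i.+1 right (left p)).
    rewrite iterSr leftK; case: i => [|i] //=.
    by rewrite rE -uR -iterSr.
  case: l lE => [|a l] lE; (split=> //; last move=> i).
  + by rewrite -[left p]/(iter 0 left (left p)) uL -lE.
  + by rewrite uL -lE !nth_nil.
  + by rewrite -[left p]/(iter 0 left (left p)) uL -lE.
  + by rewrite uL -lE.
- have L i : nth SB (w :: l) i = upd T p w (iter i.+1 left (right p)).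
    rewrite iterSr rightK; case: i => [|i] //=.
    by rewrite lE -uL -iterSr.
  case: r rE => [|a r] rE; (split=> //; last move=> i).
  + by rewrite -[right p]/(iter 0 right (right p)) uR -rE.
  + by rewrite uR -rE !nth_nil.
  + by rewrite -[right p]/(iter 0 right (right p)) uR -rE.
  + by rewrite uR -rE.
- by split=> // i; rewrite -?iterS iterSr ?uL ?uR ?lE ?rE.
Qed.

Lemma mrun_tm (M : mach) o T p o' T' p' t tp :
  @mrun M o T p o' T' p' t -> rep T p tp ->
  exists2 tp', iter t (@tm_step (tm_of M)) (o, tp) = (o', tp') & rep T' p' tp'.
Proof.
move=> H; elim: H tp => [{}o {}T {}p|q {}T {}p {}o w m {}o' {}T' {}p' {}t e _ IH] tp R.
  by exists tp.
rewrite iterSr; case: tp R => [[l h] r] R.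
have [hE _ _] := R; have := rep_step w m R => /IH [tp' E' R'].
exists tp' => //; rewrite -E'; congr (iter _ _ _).
by rewrite /= hE e; case: m {e R R' E' IH} => //; [case: l|case: r].
Qed.

(** [readbits] stops at the first blank, and the default of [nth] puts a blank right after [y]. *)
Lemma rep_readbits T p tp y : rep T p tp ->
  (forall i, T (iter i right p) = nth SB (map bsym y) i) ->
  forall M (q : tm_state M), tm_output (q, tp) = y.
Proof.
case: tp => [[l h] r] [hE _ rE] H M q /=.
have N i : nth SB (h :: r) i = nth SB (map bsym y) i.
  by case: i => [|i]; rewrite -H //= rE.
change (readbits (h :: r) = y).
elim: y (h :: r) {H} N => [|b y IH] [|a s] //= N.
- by have := N 0 => /= ->.
- by have := N 0; case: b {N IH}.
- have /= -> := N 0; have -> : y = readbits s by rewrite (IH s) // => i; exact: (N i.+1).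
  by case: b {N}.
Qed.

Definition init_tape (x : seq bool) : itape :=
  fun p => if p is Posz n then nth SB (map bsym x) n else SB.

Lemma rep_init M x : rep (init_tape x) 0 (tm_init M x).2.
Proof.
have L i : iter i.+1 left 0 = Negz i by elim: i => //= i ->.
have R i : iter i right 0 = Posz i by elim: i => //= i ->.
by case: x => [|b x]; split=> // i; rewrite ?L ?R /= ?nth_nil.
Qed.

Lemma computes_ex c x y T p t b :
  ex c (init_tape x) 0 T p t -> t <= b ->
  (forall i, T (iter i right p) = nth SB (map bsym y) i) ->
  computes_within (tm_of (compile c)) x y b.
Proof.
move=> /compile_correct H tb O; exists t; split=> //.
have [tp' E R] := mrun_tm H (rep_init (tm_of (compile c)) x).
have -> : tm_init (tm_of (compile c)) x
  = (Some (st0 (compile c)), (tm_init (tm_of (compile c)) x).2) by case: x {H E}.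
by rewrite E; split=> //; apply: rep_readbits R O _ _.
Qed.

(** * Execution within a time bound *)

Definition exb c T p T' p' b := exists2 t, t <= b & ex c T p T' p' t.

Lemma exb_seq c1 c2 T1 p1 T2 p2 T3 p3 b1 b2 b :
  exb c1 T1 p1 T2 p2 b1 -> exb c2 T2 p2 T3 p3 b2 -> b1 + b2 <= b ->
  exb (Seq c1 c2) T1 p1 T3 p3 b.
Proof.
move=> [t1 H1 E1] [t2 H2 E2] le; exists (t1 + t2); last exact: ex_seq E1 E2.
exact: leq_trans (leq_add H1 H2) le.
Qed.

Lemma exb_leq c T p T' p' b b' : b <= b' -> exb c T p T' p' b -> exb c T p T' p' b'.
Proof. by move=> le [t H E]; exists t => //; apply: leq_trans le. Qed.

Lemma exb_write w m T p : exb (Act (fun=> w) m) T p (upd T p w) (mv m p) 1.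
Proof. by exists 1 => //; apply: ex_act. Qed.

Lemma exb_move m T p : exb (Act id m) T p T (mv m p) 1.
Proof. by exists 1 => //; rewrite -{2}(upd_same T p); apply: ex_act. Qed.

Lemma exb_if (b : pred sym) c1 c2 T p T' p' t :
  exb (if b (T p) then c1 else c2) T p T' p' t -> exb (If b c1 c2) T p T' p' t.+1.
Proof.
by case: ifP => bT [t' le E]; exists t'.+1 => //; [apply: ex_ifT|apply: ex_ifF; rewrite ?bT].
Qed.

Lemma exb_while0 (b : pred sym) c T p : ~~ b (T p) -> exb (While b c) T p T p 1.
Proof. by exists 1 => //; apply: ex_whF. Qed.

(* The index [i] counts down the [n] remaining iterations. *)
Lemma exb_while (b : pred sym) c (F : nat -> itape) (f : nat -> int) n t :
  ~~ b (F 0 (f 0)) ->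
  (forall i, i < n -> b (F i.+1 (f i.+1)) /\ exb c (F i.+1) (f i.+1) (F i) (f i) t) ->
  exb (While b c) (F n) (f n) (F 0) (f 0) (n * t.+1).+1.
Proof.
move=> H0; elim: n => [|n IH] H; first exact: exb_while0.
have [bT [t1 le1 E1]] := H n (leqnn _).
have [t2 le2 E2] := IH (fun i lt => H i (leqW lt)).
by exists (t1 + t2).+1; [rewrite mulSn; lia|apply: ex_whT E1 E2].
Qed.

(** * Registers on interleaved tracks *)

Definition isS1 : pred sym := fun s => if s is S1 then true else false.
Definition isSB : pred sym := fun s => if s is SB then true else false.
Definition nonSB : pred sym := fun s => if s is SB then false else true.
Definition nonS0 : pred sym := fun s => if s is S0 then false else true.

Fixpoint moves (m : move) (k : nat) : prog :=
  if k is k'.+1 then Seq (Act id m) (moves m k') else Act id MN.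

Lemma exb_moves m k T p : exb (moves m k) T p T (iter k (mv m) p) k.+1.
Proof.
elim: k p => [|k IH] p; first exact: exb_move.
by rewrite iterSr; apply: exb_seq (exb_move _ _ _) (IH _) _.
Qed.

Lemma iter_left_Negz k a : iter k left (Negz a) = Negz (a + k).
Proof. by elim: k => [|k IH]; rewrite ?addn0 // addnS iterS IH. Qed.

Lemma iter_right_Negz k a : iter k right (Negz (a + k)) = Negz a.
Proof. by elim: k => [|k IH]; rewrite ?addn0 // addnS iterSr /= IH. Qed.

Definition ntr := 16.

(* Bit [p] of track [j < ntr] sits in cell number [p * ntr + j] to the left of the
   home cell, which is marked by the only [S0] outside the input and the output. *)
Definition tape_of (mem : nat -> nat -> bool) (Rt : nat -> sym) : itape :=
  fun p => match p with
    | Posz n => Rt n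
    | Negz 0 => S0
    | Negz n.+1 => if mem (n %% ntr) (n %/ ntr) then S1 else SB
    end.

Definition home : int := Negz 0.
Definition zone (j p : nat) : int := Negz (p * ntr + j).+1.

Definition set_bit (mem : nat -> nat -> bool) (d r : nat) (b : bool) :=
  fun j p => if (j == d) && (p == r) then b else mem j p.

Lemma tape_zone mem Rt j p : j < ntr ->
  tape_of mem Rt (zone j p) = if mem j p then S1 else SB.
Proof. by move=> lj; rewrite /= modnMDl modn_small // divnMDl // divn_small // addn0. Qed.

(** Uniqueness of quotient and remainder modulo [ntr]: one cell belongs to exactly one bit of one
    track. *)
Lemma upd_zone mem Rt d r b : d < ntr ->
  upd (tape_of mem Rt) (zone d r) (if b then S1 else SB) = tape_of (set_bit mem d r b) Rt.
Proof.
move=> ld; apply: functional_extensionality => -[n|[|n]] //; rewrite /upd /zone.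
have -> : (Negz n.+1 == Negz (r * ntr + d).+1) = (n %% ntr == d) && (n %/ ntr == r).
  apply/eqP/andP => [[->]|[/eqP <- /eqP <-]]; last by rewrite -divn_eq.
  by rewrite modnMDl modn_small // divnMDl // divn_small // addn0.
by rewrite /tape_of /set_bit; case: ifP.
Qed.

Definition go_home := While nonS0 (Act id MR).

(** The tracks contain only [S1] and [SB], so the first [S0] met on the way to the right is the home
    cell. *)
Lemma exb_home mem Rt a : exb go_home (tape_of mem Rt) (Negz a) (tape_of mem Rt) home (a * 2).+1.
Proof.
apply: (exb_while (F := fun=> tape_of mem Rt) (f := Negz)) => // i _.
by split; [rewrite /=; case: (mem _ _)|apply: exb_move].
Qed.

(* Register [i] is in unary: the index of its first blank cell is its value. *)
Definition goto i d :=
  Seq (moves ML i.+1) (Seq (While isS1 (moves ML ntr)) (Seq (moves MR i) (moves ML d))).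

Lemma exb_goto mem Rt i d r : i < ntr -> d < ntr ->
  (forall p, mem i p = (p < r)) ->
  exb (goto i d) (tape_of mem Rt) home (tape_of mem Rt) (zone d r) (60 + 20 * r).
Proof.
move=> li ld H; pose T := tape_of mem Rt.
apply: exb_seq (exb_moves ML i.+1 T home) _ _.
  rewrite iter_left_Negz add0n.
  (* Each round takes one test and the 17 steps of [moves ML ntr]. *)
  have W : exb (While isS1 (moves ML ntr)) T (zone i 0) T (zone i r) (r * 18).+1.
    rewrite -[in X in exb _ _ X](subnn r) -[in X in exb _ _ _ _ X](subn0 r).
    apply: (exb_while (F := fun=> T) (f := fun k => zone i (r - k))).
      by cbv beta; rewrite /T tape_zone // H subn0 ltnn.
    move=> k lk; split; first by cbv beta; rewrite /T tape_zone // H; have -> : r - k.+1 < r by lia.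
    have -> : zone i (r - k) = iter ntr left (zone i (r - k.+1)).
      rewrite /zone iter_left_Negz; congr Negz; rewrite /ntr; lia.
    exact: exb_moves.
  apply: exb_seq W _ _.
    apply: exb_seq (exb_moves MR i T _) _ _.
      rewrite /zone -addSn iter_right_Negz.
      have -> : Negz (r * ntr + d).+1 = iter d left (Negz (r * ntr).+1).
        by rewrite iter_left_Negz addSn.
      exact: exb_moves.
    exact: leqnn.
  exact: leqnn.
rewrite /ntr in li ld *; lia.
Qed.

Record state := State { reg : nat -> nat; arr : nat -> bool; rgt : nat -> sym }.

(** Track 0 is the bit array, so register numbers start at 1, as [is_reg] requires. *)
Definition mem_of (s : state) : nat -> nat -> bool :=
  fun j p => if j == 0 then arr s p else p < reg s j.

Definition tp (s : state) : itape := tape_of (mem_of s) (rgt s).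

Definition setr (f : nat -> nat) d x := fun j => if j == d then x else f j.

Definition set_reg (s : state) d x := State (setr (reg s) d x) (arr s) (rgt s).

Definition set_arr (s : state) q :=
  State (reg s) (fun p => (p == q) || arr s p) (rgt s).

Definition cost B := 256 * (B + 1).

Definition is_reg i := 0 < i < ntr.

(** Reads on track [d] the bit whose index is in register [i]. On a unary register this decides
    whether register [i] is smaller than register [d]; on track 0 it looks up the array. *)
Definition test i d c1 c2 := Seq (goto i d) (If isS1 (Seq go_home c1) (Seq go_home c2)).

Lemma exb_goto_tp s i d B : is_reg i -> d < ntr -> reg s i <= B ->
  exb (goto i d) (tp s) home (tp s) (zone d (reg s i)) (60 + 20 * B).
Proof.
move=> /andP [i0 li] ld rB; have := @exb_goto (mem_of s) (rgt s) i d (reg s i) li ld.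
have H p : mem_of s i p = (p < reg s i) by rewrite /mem_of eqn0Ngt i0 /=.
by move=> /(_ H); apply: exb_leq; lia.
Qed.

Lemma exb_home_zone s d r B : d < ntr -> r <= B ->
  exb go_home (tp s) (zone d r) (tp s) home (40 + 40 * B).
Proof.
by move=> ld rB; apply: exb_leq (exb_home _ _ _); rewrite /ntr in ld *; lia.
Qed.

Lemma exb_test s i d c1 c2 s' B t : is_reg i -> d < ntr -> reg s i <= B ->
  exb (if mem_of s d (reg s i) then c1 else c2) (tp s) home (tp s') home t ->
  exb (test i d c1 c2) (tp s) home (tp s') home (t + cost B).
Proof.
move=> ri ld rB H; apply: exb_seq (exb_goto_tp ri ld rB) _ _.
  apply: exb_if; rewrite {1}/tp tape_zone //.
  have E : isS1 (if mem_of s d (reg s i) then S1 else SB) = mem_of s d (reg s i).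
    by case: (mem_of _ _ _).
  rewrite E; set c := if mem_of s d _ then Seq go_home c1 else _.
  have -> : c = Seq go_home (if mem_of s d (reg s i) then c1 else c2).
    by rewrite /c; case: (mem_of _ _ _).
  apply: exb_seq (exb_home_zone s ld rB) H (leqnn _).
rewrite /cost; lia.
Qed.

(** With [d = i] this increments register [i]; with [d = 0] it sets the array bit whose index is in
    register [i]. *)
Definition store i d := Seq (goto i d) (Seq (Act (fun=> S1) MN) go_home).

Lemma exb_store s i d B s' : is_reg i -> d < ntr -> reg s i <= B ->
  mem_of s' = set_bit (mem_of s) d (reg s i) true -> rgt s' = rgt s ->
  exb (store i d) (tp s) home (tp s') home (cost B).
Proof.
move=> ri ld rB ms rs; apply: exb_seq (exb_goto_tp ri ld rB) _ _.
  apply: exb_seq (exb_write _ _ _ _) _ _.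
    rewrite [upd _ _ _](upd_zone _ _ _ true) // -ms -rs.
    exact: (@exb_home_zone s' d (reg s i) B).
  exact: leqnn.
rewrite /cost; lia.
Qed.

Lemma exb_inc s i B : is_reg i -> reg s i <= B ->
  exb (store i i) (tp s) home (tp (set_reg s i (reg s i).+1)) home (cost B).
Proof.
move=> ri rB; have /andP [i0 li] := ri; apply: exb_store => //.
apply: functional_extensionality => j; apply: functional_extensionality => p.
rewrite /mem_of /set_bit /= /setr.
case: (eqVneq j i) => [->|] //=; rewrite eqn0Ngt i0 /= ltnS leq_eqVlt.
by case: eqP.
Qed.

Lemma exb_set_arr s i B : is_reg i -> reg s i <= B ->
  exb (store i 0) (tp s) home (tp (set_arr s (reg s i))) home (cost B).
Proof.
move=> ri rB; apply: exb_store => //.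
apply: functional_extensionality => j; apply: functional_extensionality => p.
by rewrite /mem_of /set_bit /=; case: (j == 0) => //=; case: eqP.
Qed.

Definition clear i :=
  Seq (moves ML i.+1)
    (Seq (While isS1 (Seq (Act (fun=> SB) MN) (moves ML ntr))) go_home).

Lemma exb_clear s i B : is_reg i -> reg s i <= B ->
  exb (clear i) (tp s) home (tp (set_reg s i 0)) home (cost B).
Proof.
move=> ri rB; have /andP [i0 li] := ri; set r := reg s i.
(* Erasing starts at the low end, so in between the track holds a shifted block of [k] ones and is
   not a register. *)
pose mem k := fun j p => if j == i then r - k <= p < r else mem_of s j p.
apply: exb_seq (exb_moves ML i.+1 _ home) _ _.
  rewrite iter_left_Negz add0n.
  have W : exb (While isS1 (Seq (Act (fun=> SB) MN) (moves ML ntr)))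
      (tp s) (zone i 0) (tp (set_reg s i 0)) (zone i r) (r * 20).+1.
    have E1 : tp s = tape_of (mem r) (rgt s).
      congr tape_of; apply: functional_extensionality => j.
      apply: functional_extensionality => p; rewrite /mem /mem_of.
      by case: (eqVneq j i) => // ->; rewrite eqn0Ngt i0 /= subnn.
    have E2 : tp (set_reg s i 0) = tape_of (mem 0) (rgt s).
      congr tape_of; apply: functional_extensionality => j.
      apply: functional_extensionality => p; rewrite /mem /mem_of /= /setr.
      case: (eqVneq j i) => // ->; rewrite eqn0Ngt i0 /= subn0; lia.
    rewrite E1 E2 -[in X in exb _ _ X](subnn r) -[in X in exb _ _ _ _ X](subn0 r).
    apply: (exb_while (F := fun k => tape_of (mem k) (rgt s))
                      (f := fun k => zone i (r - k))).
      by cbv beta; rewrite tape_zone // /mem eqxx subn0 ltnn andbF.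
    move=> k lk; split; first by cbv beta; rewrite tape_zone // /mem eqxx leqnn; have -> : r - k.+1 < r by lia.
    apply: exb_seq (exb_write _ _ _ _) _ _.
      rewrite [upd _ _ _](upd_zone _ _ _ false) //.
      have -> : set_bit (mem k.+1) i (r - k.+1) false = mem k.
        apply: functional_extensionality => j; apply: functional_extensionality => p.
        rewrite /set_bit /mem; case: (j == i) => //=; case: eqP => H; lia.
      have -> : zone i (r - k) = iter ntr left (zone i (r - k.+1)).
        rewrite /zone iter_left_Negz; congr Negz; rewrite /ntr; lia.
      exact: exb_moves.
    by [].
  apply: exb_seq W (@exb_home_zone (set_reg s i 0) i r B _ _) _ => //; exact: leqnn.
rewrite /cost; rewrite /ntr in li; lia.
Qed.

(* The first [c] input bits have been consumed, [x] remains. *)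
Definition inp (c : nat) (x : seq bool) : nat -> sym :=
  fun p => if p < c then SB else nth SB (map bsym x) (p - c).

(** The output starts in cell 1; the blank cell 0 stops the walk back over the output. *)
Definition outp (o : seq bool) : nat -> sym :=
  fun p => if p is p'.+1 then nth SB (map bsym o) p' else SB.

Lemma inp_nil c : inp c [::] = outp [::].
Proof.
apply: functional_extensionality => p; rewrite /inp /= nth_nil if_same.
by case: p => //= p; rewrite nth_nil.
Qed.

(** * Consuming the input and appending to the output *)

Definition goto_input := Seq (Act id MR) (While isSB (Act id MR)).

Definition consume := Seq (Act (fun=> SB) ML) (While isSB (Act id ML)).

Lemma exb_goto_input mem c b x B : c <= B ->
  exb goto_input (tape_of mem (inp c (b :: x))) home
                 (tape_of mem (inp c (b :: x))) (Posz c) (2 * B + 2).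
Proof.
move=> cB; set T := tape_of _ _; apply: exb_seq (exb_move _ _ _) _ _.
  rewrite -[mv _ _](congr1 Posz (subnn c)) -[in X in exb _ _ _ _ X](subn0 c).
  apply: (exb_while (F := fun=> T) (f := fun k => Posz (c - k))).
    by rewrite /T /= /inp subn0 ltnn subnn; case: b {T}.
  move=> i li; split; first by rewrite /T /= /inp; have -> : c - i.+1 < c by lia.
  have -> : Posz (c - i) = right (Posz (c - i.+1)) by rewrite /=; congr Posz; lia.
  exact: exb_move.
lia.
Qed.

Lemma exb_consume mem c b x B : c <= B ->
  exb consume (tape_of mem (inp c (b :: x))) (Posz c)
              (tape_of mem (inp c.+1 x)) home (2 * B + 4).
Proof.
move=> cB; apply: exb_seq (exb_write _ _ _ _) _ _.
  have -> : upd (tape_of mem (inp c (b :: x))) (Posz c) SB = tape_of mem (inp c.+1 x).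
    apply: functional_extensionality => -[n|n] //; rewrite /upd /= /inp.
    have -> : (Posz n == Posz c) = (n == c) by [].
    case: (ltngtP n c) => H; last by rewrite H leqnn.
      by rewrite (leqW H).
    by rewrite ltnNge H /=; have -> : n - c = (n - c.+1).+1 by lia.
  set T := tape_of _ _.
  pose f k := if k is k'.+1 then Posz k' else home.
  have E k : mv ML (Posz k) = f k by case: k.
  rewrite E; apply: (exb_while (F := fun=> T) (f := f)) => // i li.
  split; last by rewrite -E; apply: exb_move.
  by rewrite /T /= /inp ltnS (ltnW li).
lia.
Qed.

Definition out b :=
  Seq (moves MR 2) (Seq (While nonSB (Act id MR)) (Seq (Act (fun=> bsym b) ML)
    (Seq (While nonSB (Act id ML)) (Act id ML)))).

Lemma exb_out mem o b B : size o <= B ->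
  exb (out b) (tape_of mem (outp o)) home (tape_of mem (outp (rcons o b))) home (cost B).
Proof.
move=> oB; set T := tape_of _ _; set T' := tape_of _ _; pose n := size o.
have N k : k < n -> nonSB (nth SB (map bsym o) k).
  by move=> lk; rewrite (nth_map false) //; case: (nth _ _ _).
apply: exb_seq (exb_moves _ _ _ _) _ _.
  have W1 : exb (While nonSB (Act id MR)) T (Posz 1) T (Posz n.+1) (n * 2).+1.
    rewrite -[in X in exb _ _ X](subnn n) -[in X in exb _ _ _ _ X](subn0 n).
    apply: (exb_while (F := fun=> T) (f := fun k => Posz (n - k).+1)).
      by rewrite /T /= nth_default // size_map subn0.
    move=> k lk; split; first by rewrite /T /= N //; lia.
    have -> : n - k = (n - k.+1).+1 by lia.
    exact: exb_move.
  apply: exb_seq W1 _ _.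
    apply: exb_seq (exb_write _ _ _ _) _ _.
      have -> : upd T (Posz n.+1) (bsym b) = T'.
        apply: functional_extensionality => -[[|p]|p] //; rewrite /upd /T' /T /=.
        have -> : (Posz p.+1 == Posz n.+1) = (p == n) by [].
        rewrite map_rcons nth_rcons size_map -/n.
        case: ltngtP => // H; rewrite nth_default // size_map; exact: ltnW.
      have W2 : exb (While nonSB (Act id ML)) T' (Posz n) T' (Posz 0) (n * 2).+1.
        apply: (exb_while (F := fun=> T') (f := Posz)) => // i li.
        split; last exact: exb_move.
        by rewrite /T' /= map_rcons nth_rcons size_map li; apply: N.
      apply: exb_seq W2 (exb_move _ _ _) (leqnn _).
    exact: leqnn.
  exact: leqnn.
rewrite /cost /n; lia.
Qed.

(** * Running times and loops *)

Definition runs B e c s s' := exb c (tp s) home (tp s') home ((B + 2) ^ e).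

(** Both powers are at least 1, so the sum is at most twice the product, and the extra factor
    [B + 2] absorbs the 2. Thus exponents add up along a program whatever [B] is. *)
Lemma expD_leq B a b : (B + 2) ^ a + (B + 2) ^ b <= (B + 2) ^ (a + b).+1.
Proof.
have h k : 0 < (B + 2) ^ k by rewrite expn_gt0; lia.
rewrite expnS expnD; have := h a; have := h b.
move: ((B + 2) ^ a) ((B + 2) ^ b) => x y hx hy; nia.
Qed.

Lemma exp_leq B a b : a <= b -> (B + 2) ^ a <= (B + 2) ^ b.
Proof. by move=> le; rewrite leq_pexp2l //; lia. Qed.

Lemma cost_leq B : cost B <= (B + 2) ^ 9.
Proof.
rewrite /cost expnSr; apply: leq_mul; last by lia.
by apply: (@leq_trans (2 ^ 8)); rewrite // leq_exp2r //; lia.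
Qed.

Lemma runs_leq B e e' c s s' : e <= e' -> runs B e c s s' -> runs B e' c s s'.
Proof. by move=> le; apply: exb_leq; apply: exp_leq. Qed.

Lemma runs_seq B e1 e2 c1 c2 s1 s2 s3 :
  runs B e1 c1 s1 s2 -> runs B e2 c2 s2 s3 -> runs B (e1 + e2).+1 (Seq c1 c2) s1 s3.
Proof. by move=> H1 H2; apply: exb_seq H1 H2 (expD_leq _ _ _). Qed.

Lemma runs_inc B s i : is_reg i -> reg s i <= B ->
  runs B 9 (store i i) s (set_reg s i (reg s i).+1).
Proof. by move=> ri rB; apply: exb_leq (cost_leq B) (exb_inc ri rB). Qed.

Lemma runs_set_arr B s i : is_reg i -> reg s i <= B ->
  runs B 9 (store i 0) s (set_arr s (reg s i)).
Proof. by move=> ri rB; apply: exb_leq (cost_leq B) (exb_set_arr ri rB). Qed.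

Lemma runs_clear B s i : is_reg i -> reg s i <= B -> runs B 9 (clear i) s (set_reg s i 0).
Proof. by move=> ri rB; apply: exb_leq (cost_leq B) (exb_clear ri rB). Qed.

Lemma runs_out B s o b : rgt s = outp o -> size o <= B ->
  runs B 9 (out b) s (State (reg s) (arr s) (outp (rcons o b))).
Proof.
move=> so oB; rewrite /runs {1}/tp so.
exact: exb_leq (cost_leq B) (exb_out (mem_of s) b oB).
Qed.

Lemma runs_test B e s s' i d c1 c2 : is_reg i -> d < ntr -> reg s i <= B ->
  runs B e (if mem_of s d (reg s i) then c1 else c2) s s' ->
  runs B (e + 10) (test i d c1 c2) s s'.
Proof.
move=> ri ld rB H; apply: exb_leq (exb_test ri ld rB H).
by rewrite (addnS e 9); apply: leq_trans (expD_leq _ _ _); rewrite leq_add2l cost_leq.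
Qed.

(** * Timed total-correctness triples and bounded loops *)

Definition tri B e c (P Q : state -> Prop) :=
  forall s, P s -> exists2 s', Q s' & runs B e c s s'.

Lemma tri_conseq B e e' c (P P' Q Q' : state -> Prop) : e <= e' ->
  (forall s, P' s -> P s) -> (forall s, Q s -> Q' s) ->
  tri B e c P Q -> tri B e' c P' Q'.
Proof.
move=> le HP HQ H s /HP /H [s' /HQ Qs' R]; exists s' => //; exact: runs_leq le R.
Qed.

Lemma tri_seq B e1 e2 c1 c2 (P Q R : state -> Prop) :
  tri B e1 c1 P Q -> tri B e2 c2 Q R -> tri B (e1 + e2).+1 (Seq c1 c2) P R.
Proof.
move=> H1 H2 s /H1 [s1 /H2 [s2 Rs2 E2] E1]; exists s2 => //; exact: runs_seq E1 E2.
Qed.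

Definition for_loop i b c :=
  Seq (clear i) (Seq (goto i b)
    (Seq (While isS1 (Seq go_home (Seq c (Seq (store i i) (goto i b))))) go_home)).

(** [I j] is the invariant before round [j]. The overhead 13 is made up of 9 for the register
    operations, 1 for the number of rounds and 3 for a constant factor 6. *)
Lemma tri_for B e i b c n (I : nat -> state -> Prop) (P : state -> Prop) :
  is_reg i -> is_reg b -> n <= B ->
  (forall j s, I j s -> reg s i = j /\ reg s b = n) ->
  (forall s, P s -> reg s i <= B /\ I 0 (set_reg s i 0)) ->
  (forall j, j < n -> tri B e c (I j) (fun s => reg s i = j /\ I j.+1 (set_reg s i j.+1))) ->
  tri B (e + 13) (for_loop i b c) P (I n).
Proof.
move=> ri rb nB HI HP Hc s Ps.
have /andP [b0 lb] := rb.
have [sB I0] := HP s Ps.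
have M j s1 : I j s1 -> tape_of (mem_of s1) (rgt s1) (zone b j) = if j < n then S1 else SB.
  by case/HI => _ En; rewrite tape_zone // /mem_of eqn0Ngt b0 /= En.
rewrite /runs /for_loop; set body := Seq go_home _.
pose t := (B + 2) ^ e + 2 * cost B.
(* The states between rounds are only known to exist, not given as a function of the index as in
   [exb_while]; hence a separate induction on the remaining rounds. *)
have W k s1 : k <= n -> I (n - k) s1 -> exists2 s2, I n s2 &
    exb (While isS1 body) (tp s1) (zone b (n - k)) (tp s2) (zone b n) (k * t.+1).+1.
  elim: k s1 => [|k IH] s1 lk I1.
    rewrite subn0 in I1 *; exists s1 => //.
    by apply: exb_while0; rewrite /tp (M _ _ I1) ltnn.
  have lt : n - k.+1 < n by lia.
  have [s2 [E2 I2] R2] := Hc _ lt s1 I1.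
  have eS : (n - k.+1).+1 = n - k by lia.
  rewrite eS in I2; have [s3 I3 [t3 le3 R3]] := IH _ (ltnW lk) I2; exists s3 => //.
  have : exb body (tp s1) (zone b (n - k.+1))
      (tp (set_reg s2 i (n - k))) (zone b (n - k)) t.
    apply: (exb_seq (exb_home_zone (B := B) s1 lb _)); first by lia.
      apply: (exb_seq R2).
        have := @exb_inc s2 i B ri; rewrite E2 eS => H.
        apply: (exb_seq (H _)); first by lia.
          have /= := @exb_goto_tp (set_reg s2 i (n - k)) i b B ri lb.
          by rewrite /setr eqxx; apply; lia.
        exact: leqnn.
      exact: leqnn.
    rewrite /t /cost; lia.
  case=> t2 le2 {}R2; exists (t2 + t3).+1; first by rewrite mulSn; lia.
  by apply: ex_whT R2 R3; rewrite /tp (M _ _ I1) lt.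
have [|s2 I2 R2] := W n (set_reg s i 0) (leqnn n); first by rewrite subnn.
exists s2 => //.
apply: (exb_seq (exb_clear ri sB)).
  apply: (exb_seq (exb_goto_tp (B := B) ri lb _)); first by rewrite /= /setr eqxx.
    have -> : zone b (reg (set_reg s i 0) i) = zone b (n - n) by rewrite subnn /= /setr eqxx.
    apply: (exb_seq R2 (exb_home_zone s2 lb nB)); exact: leqnn.
  exact: leqnn.
have : n * t.+1 + t.+1 <= (B + 2) * t.+1 by rewrite -mulSnr leq_mul2r; lia.
have : t.+1 + cost B <= 6 * (B + 2) ^ (e + 9).
  have := cost_leq B; have : 0 < cost B by rewrite /cost; lia.
  have : (B + 2) ^ e <= (B + 2) ^ (e + 9) by apply: exp_leq; lia.
  have : (B + 2) ^ 9 <= (B + 2) ^ (e + 9) by apply: exp_leq; lia.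
  rewrite /t; lia.
have : 6 * (B + 2) ^ (e + 10) <= (B + 2) ^ (e + 13).
  rewrite (_ : e + 13 = 3 + (e + 10)); last lia.
  rewrite [X in _ <= X]expnD leq_mul2r; apply/orP; right.
  by apply: (@leq_trans (2 ^ 3)); rewrite // leq_exp2r //; lia.
rewrite (addnS e 9) expnS.
move: ((B + 2) ^ (e + 9)) ((B + 2) ^ (e + 13)) => x y; rewrite /t /cost.
move: ((B + 2) ^ e) => z; clear -nB; nia.
Qed.

(** * Computing an array index by repeated increments *)

Definition scr1 := 13.
Definition scr2 := 14.

Definition mul_add x u w v :=
  Seq (clear x) (Seq (for_loop scr1 u (for_loop scr2 w (store x x)))
                     (for_loop scr1 v (store x x))).

Definition bounded B (s : state) := forall j, reg s j <= B.

Lemma bounded_set B s i x : x <= B -> bounded B s -> bounded B (set_reg s i x).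
Proof. by move=> xB H j; rewrite /= /setr; case: ifP. Qed.

Definition frame (X : seq nat) (s s' : state) :=
  [/\ arr s' = arr s, rgt s' = rgt s & forall j, j \notin X -> reg s' j = reg s j].

Lemma frame_set X s s' i x : i \in X -> frame X s s' -> frame X s (set_reg s' i x).
Proof.
move=> iX [Ea Er H]; split=> // j jX; rewrite /= /setr; case: eqP => [ji|_]; last exact: H.
by rewrite ji iX in jX.
Qed.

(** The invariant [Inv q] says that [x] has reached [q] and that, apart from it, only the two
    scratch counters changed. The exponents of the nested loops add up to 68, rounded up to 80. *)
Lemma tri_mul_add B x u w v (s0 : state) :
  is_reg x -> is_reg u -> is_reg w -> is_reg v ->
  x \notin [:: u; w; v; scr1; scr2] ->
  all (fun j => (j != scr1) && (j != scr2)) [:: u; w; v] ->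
  bounded B s0 -> reg s0 u * reg s0 w + reg s0 v <= B ->
  tri B 80 (mul_add x u w v) (eq s0)
    (fun s => [/\ bounded B s, frame [:: x; scr1; scr2] s0 s &
                  reg s x = reg s0 u * reg s0 w + reg s0 v]).
Proof.
move=> rx ru rw rv xn; rewrite /= andbT => /and3P [/andP [u1 u2] /andP [w1 w2] /andP [v1 v2]].
move: xn; rewrite !inE !negb_or => /and5P [xu xw xv x1 x2] bB valB.
pose X := [:: x; scr1; scr2].
pose Inv q s := [/\ bounded B s, frame X s0 s & reg s x = q].
have inv_scr q s z k : z \in [:: scr1; scr2] -> k <= B -> Inv q s -> Inv q (set_reg s z k).
  move=> zs kB [Hb Hf Hx]; split; first exact: bounded_set.
    by apply: frame_set => //; rewrite inE zs orbT.
  rewrite /= /setr; case: eqP => // xz; move: zs; rewrite -xz !inE.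
  by rewrite (negPf x1) (negPf x2).
have inv_reg q s y : Inv q s -> y \notin X -> reg s y = reg s0 y.
  by case=> _ [_ _ H] _ /H.
have uX : u \notin X by rewrite !inE !negb_or eq_sym xu u1 u2.
have wX : w \notin X by rewrite !inE !negb_or eq_sym xw w1 w2.
have vX : v \notin X by rewrite !inE !negb_or eq_sym xv v1 v2.
have inc q z k : z \in [:: scr1; scr2] -> q < B ->
    tri B 9 (store x x) (fun s => Inv q s /\ reg s z = k)
                        (fun s => Inv q.+1 s /\ reg s z = k).
  move=> zs lt s [[Hb Hf Hx] Hz]; exists (set_reg s x q.+1); last first.
    by rewrite -Hx; apply: runs_inc.
  have zx : (z == x) = false.
    by apply/eqP => zx; move: zs; rewrite zx !inE (negPf x1) (negPf x2).
  split; last by rewrite /= /setr zx.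
  split; first exact: bounded_set.
    by apply: frame_set => //; rewrite inE eqxx.
  by rewrite /= /setr eqxx.
have wB : reg s0 w <= B by apply: bB.
have vB : reg s0 v <= B by apply: bB.
have uB : reg s0 u <= B by apply: bB.
set a := reg s0 u in valB uB *; set b := reg s0 w in valB wB *; set c := reg s0 v in valB vB *.
have T1 : tri B 9 (clear x) (eq s0) (Inv 0).
  move=> s <-; exists (set_reg s0 x 0); last by apply: runs_clear => //; apply: bB.
  split; first exact: bounded_set.
    by apply: frame_set; rewrite ?inE ?eqxx.
  by rewrite /= /setr eqxx.
have T3 : tri B 22 (for_loop scr1 v (store x x)) (Inv (a * b)) (Inv (a * b + c)).
  apply: (@tri_conseq B 22 22 _ (Inv (a * b)) _
     (fun s => Inv (a * b + c) s /\ reg s scr1 = c)) => //; first by move=> s [].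
  apply: (@tri_for B 9 scr1 v _ c (fun j s => Inv (a * b + j) s /\ reg s scr1 = j)) => //.
  - by move=> j s [Is ->]; split=> //; apply: inv_reg Is vX.
  - move=> s Is; split; first by case: Is => Hb _ _; apply: Hb.
    by rewrite addn0; split; first exact: inv_scr.
  - move=> j lj; have lt : a * b + j < B by lia.
    apply: (tri_conseq (leqnn _) (fun s H => H) _ (inc _ scr1 j _ lt)) => //.
    move=> s [Is Hs]; split=> //; rewrite addnS; split; last by rewrite /= /setr.
    by apply: inv_scr => //; lia.
have T2 : tri B 35 (for_loop scr1 u (for_loop scr2 w (store x x))) (Inv 0) (Inv (a * b)).
  apply: (@tri_conseq B 35 35 _ (Inv 0) _
     (fun s => Inv (a * b) s /\ reg s scr1 = a)) => //; first by move=> s [].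
  apply: (@tri_for B 22 scr1 u _ a (fun j s => Inv (j * b) s /\ reg s scr1 = j)) => //.
  - by move=> j s [Is ->]; split=> //; apply: inv_reg Is uX.
  - move=> s Is; split; first by case: Is => Hb _ _; apply: Hb.
    by split; first exact: inv_scr.
  - move=> j lj; have le : j.+1 * b <= a * b by rewrite leq_mul2r lj orbT.
    pose J k s := (Inv (j * b + k) s /\ reg s scr1 = j) /\ reg s scr2 = k.
    apply: (@tri_conseq B 22 22 _ (fun s => Inv (j * b) s /\ reg s scr1 = j) _ (J b)) => //.
      move=> s [[Is Hs] _]; split=> //; split; last by rewrite /= /setr.
      by apply: inv_scr; rewrite // ?mulSnr //; lia.
    apply: (@tri_for B 9 scr2 w _ b J) => //.
    + by move=> k s [[Is _] ->]; split=> //; apply: inv_reg Is wX.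
    + move=> s [Is Hs]; split; first by case: Is => Hb _ _; apply: Hb.
      by rewrite /J addn0; split=> //; split=> //; apply: inv_scr.
    + move=> k lk; have lt : j * b + k < B by rewrite mulSnr in le; lia.
      move=> s [[Is Hs1] Hs2].
      have [s' [Is' Hs2'] R] := inc _ scr2 k isT lt s (conj Is Hs2).
      have [s'' [_ Hs1'] R'] := inc _ scr1 j isT lt s (conj Is Hs1).
      exists (set_reg s x (j * b + k).+1); last first.
        by case: Is => Hb Hf <-; apply: runs_inc.
      have H1 : (scr1 == x) = false by rewrite eq_sym; apply: negPf.
      have H2 : (scr2 == x) = false by rewrite eq_sym; apply: negPf.
      have Is1 : Inv (j * b + k).+1 (set_reg s x (j * b + k).+1).
        case: Is => Hb Hf Hx; split; first exact: bounded_set.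
          by apply: frame_set => //; rewrite inE eqxx.
        by rewrite /= /setr eqxx.
      split; first by rewrite /= /setr H2.
      rewrite /J addnS; split; last by rewrite /= /setr.
      split; last by rewrite /= /setr H1.
      by apply: inv_scr => //; lia.
have T23 := tri_seq T2 T3.
by apply: tri_conseq (tri_seq T1 T23).
Qed.

(** * Printing programs *)

Inductive bexp :=
  | BConst of bool
  | BLt of nat & nat
  | BEq of nat & nat
  | BNot of bexp
  | BAnd of bexp & bexp
  | BOr of bexp & bexp.

(* Track 0 is the bit array: [BLt i 0] tests the bit whose index is in register [i]. *)
Fixpoint beval (A : nat -> bool) (r : nat -> nat) (b : bexp) : bool :=
  match b with
  | BConst b => b
  | BLt i d => if d == 0 then A (r i) else r i < r d
  | BEq i j => r i == r j
  | BNot b => ~~ beval A r b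
  | BAnd b1 b2 => beval A r b1 && beval A r b2
  | BOr b1 b2 => beval A r b1 || beval A r b2
  end.

(** Both continuations are copied into the leaves, so no truth value has to be stored. Equality is
    compiled as the failure of both strict comparisons. *)
Fixpoint bcomp (b : bexp) (c1 c2 : prog) : prog :=
  match b with
  | BConst b => if b then c1 else c2
  | BLt i d => test i d c1 c2
  | BEq i j => test i j c2 (test j i c2 c1)
  | BNot b => bcomp b c2 c1
  | BAnd b1 b2 => bcomp b1 (bcomp b2 c1 c2) c2
  | BOr b1 b2 => bcomp b1 c1 (bcomp b2 c1 c2)
  end.

Fixpoint bscoped (G : seq nat) (b : bexp) : bool :=
  match b with
  | BConst _ => true
  | BLt i d => (i \in G) && ((d == 0) || (d \in G))
  | BEq i j => (i \in G) && (j \in G)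
  | BNot b => bscoped G b
  | BAnd b1 b2 | BOr b1 b2 => bscoped G b1 && bscoped G b2
  end.

Inductive ecmd :=
  | ENop
  | EOut of bexp
  | ESeq of ecmd & ecmd
  | EFor of nat & nat & ecmd
  | EIdx of nat & nat & nat & nat & ecmd.

(** Denotational semantics: what a program prints becomes an equation between lists, independent of
    the tape. *)
Fixpoint emit (A : nat -> bool) (r : nat -> nat) (c : ecmd) : seq bool :=
  match c with
  | ENop => [::]
  | EOut b => [:: beval A r b]
  | ESeq c1 c2 => emit A r c1 ++ emit A r c2
  | EFor i b c => flatten [seq emit A (setr r i j) c | j <- iota 0 (r b)]
  | EIdx x u w v c => emit A (setr r x (r u * r w + r v)) c
  end.

Fixpoint ecomp (c : ecmd) : prog :=
  match c with
  | ENop => Act id MN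
  | EOut b => bcomp b (out true) (out false)
  | ESeq c1 c2 => Seq (ecomp c1) (ecomp c2)
  | EFor i b c => for_loop i b (ecomp c)
  | EIdx x u w v c => Seq (mul_add x u w v) (ecomp c)
  end.

Definition okreg j := is_reg j && (j \notin [:: scr1; scr2]).

(** Every bound register is fresh, so a body never overwrites a counter, a loop bound or an operand
    in scope; [okreg] protects the scratch counters of [mul_add]. *)
Fixpoint scoped (G : seq nat) (c : ecmd) : bool :=
  match c with
  | ENop => true
  | EOut b => bscoped G b
  | ESeq c1 c2 => scoped G c1 && scoped G c2
  | EFor i b c => [&& okreg i, i \notin G, b \in G & scoped (i :: G) c]
  | EIdx x u w v c =>
      [&& okreg x, x \notin G, u \in G, w \in G, v \in G & scoped (x :: G) c]
  end.

(** Loop counters are bounded by registers in scope; only computed indices call for a bound of their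
    own. *)
Fixpoint efits B (r : nat -> nat) (c : ecmd) : Prop :=
  match c with
  | ENop | EOut _ => True
  | ESeq c1 c2 => efits B r c1 /\ efits B r c2
  | EFor i b c => forall j, j < r b -> efits B (setr r i j) c
  | EIdx x u w v c => r u * r w + r v <= B /\ efits B (setr r x (r u * r w + r v)) c
  end.

Definition est B (G : seq nat) (r : nat -> nat) A o (s : state) :=
  [/\ bounded B s, forall j, j \in G -> reg s j = r j, arr s = A & rgt s = outp o].

Lemma tri_test G i d e B r A o Q c1 c2 : all okreg G -> i \in G -> (d == 0) || (d \in G) ->
  tri B e (if beval A r (BLt i d) then c1 else c2) (est B G r A o) Q ->
  tri B (e + 10) (test i d c1 c2) (est B G r A o) Q.
Proof.
move=> /allP GR iG dG H s Es.
have [s' Qs' R] := H s Es; exists s' => //; case: Es => Hb HG HA _.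
have /andP [ri _] := GR _ iG.
apply: runs_test => //.
  by case/orP: dG => [/eqP -> //|/GR /andP [/andP [] //]].
move: R; rewrite /mem_of /= -HA HG //; case: eqP dG => //= _ dG.
by rewrite HG.
Qed.

Lemma tri_bcomp G b : all okreg G -> bscoped G b ->
  exists g, forall e B r A o Q c1 c2,
    tri B e (if beval A r b then c1 else c2) (est B G r A o) Q ->
    tri B (e + g) (bcomp b c1 c2) (est B G r A o) Q.
Proof.
move=> okG; elim: b => [b|i d|i j|b IH|b1 IH1 b2 IH2|b1 IH1 b2 IH2] /=.
- by exists 0 => *; rewrite addn0.
- by case/andP=> iG dG; exists 10 => *; apply: (tri_test okG iG dG).
- case/andP=> iG jG; exists (10 + 10) => e B r A o Q c1 c2 H.
  have nz x : x \in G -> (x == 0) = false by move/(allP okG); case: x.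
  rewrite addnA; apply: (tri_test okG iG); rewrite ?jG ?orbT //= nz //.
  case: ltnP => ij; first by rewrite ltn_eqF // in H; apply: tri_conseq H => //; apply: leq_addr.
  apply: (tri_test okG jG); rewrite ?iG ?orbT //= nz //.
  by case: ltnP => ji; [rewrite gtn_eqF in H|rewrite eqn_leq ij ji in H].
- by move=> /IH [g H]; exists g => e B r A o Q c1 c2; rewrite if_neg; apply: H.
- case/andP=> /IH1 [g1 H1] /IH2 [g2 H2]; exists (g2 + g1) => e B r A o Q c1 c2 H.
  rewrite addnA; apply: H1; case: (beval A r b1) H => /= H; first exact: H2.
  by apply: tri_conseq H => //; apply: leq_addr.
- case/andP=> /IH1 [g1 H1] /IH2 [g2 H2]; exists (g2 + g1) => e B r A o Q c1 c2 H.
  rewrite addnA; apply: H1; case: (beval A r b1) H => /= H; last exact: H2.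
  by apply: tri_conseq H => //; apply: leq_addr.
Qed.

Lemma flatten_iotaS (F : nat -> seq bool) j :
  flatten [seq F k | k <- iota 0 j.+1] = flatten [seq F k | k <- iota 0 j] ++ F j.
Proof. by rewrite -addn1 iotaD map_cat flatten_cat /= cats0. Qed.

Lemma size_flatten_iota (F : nat -> seq bool) i j : i <= j ->
  size (flatten [seq F k | k <- iota 0 i]) <= size (flatten [seq F k | k <- iota 0 j]).
Proof.
by move=> le; rewrite -(subnKC le) iotaD map_cat flatten_cat size_cat leq_addr.
Qed.

(** The exponent is chosen before [B] and the environment: it depends on the program alone, which
    makes the running time polynomial in [B]. *)
Lemma tri_ecomp c G : all okreg G -> scoped G c ->
  exists e, forall B r A o, efits B r c -> size o + size (emit A r c) <= B ->
    tri B e (ecomp c) (est B G r A o) (est B G r A (o ++ emit A r c)).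
Proof.
elim: c G => [|b|c1 IH1 c2 IH2|i b c IH|x u w v c IH] G okG /=.
- move=> _; exists 1 => B r A o _ _ s Es; exists s; first by rewrite cats0.
  by apply: exb_leq (exb_move MN _ _); rewrite expn1; lia.
- move=> /(tri_bcomp okG) [g H]; exists (9 + g) => B r A o _ oB; apply: H => s [Hb HG HA Ho].
  exists (State (reg s) (arr s) (outp (rcons o (beval A r b)))).
    by rewrite cats1; split.
  have ob : size o <= B by lia.
  by case: (beval A r b); apply: runs_out.
- case/andP=> /(IH1 _ okG) [e1 H1] /(IH2 _ okG) [e2 H2]; exists (e1 + e2).+1.
  move=> B r A o [f1 f2]; rewrite size_cat => oB; rewrite catA.
  by apply: tri_seq (H1 _ _ _ _ f1 _) (H2 _ _ _ _ f2 _); rewrite ?size_cat; lia.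
- case/and4P=> oki iG bG /(IH (i :: G)) [|e H]; first by rewrite /= oki.
  exists (e + 13) => B r A o fits oB.
  have /allP GR := okG.
  have bi : (b == i) = false by apply: contraNF iG => /eqP <-.
  have ne j : j \in G -> (j == i) = false by move=> jG; apply: contraNF iG => /eqP <-.
  pose F j := emit A (setr r i j) c.
  pose I j := est B (i :: G) (setr r i j) A (o ++ flatten [seq F k | k <- iota 0 j]).
  move=> s0 Es0.
  have nB : r b <= B by case: Es0 => Hb <- //.
  have T : tri B (e + 13) (for_loop i b (ecomp c)) (est B G r A o) (I (r b)).
    apply: tri_for => //.
    + by case/andP: oki.
    + by case/andP: (GR _ bG).
    + move=> j s [_ HG _ _]; rewrite !HG ?mem_head ?inE ?bG ?orbT //.
      by rewrite /setr eqxx bi.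
    + move=> s [Hb HG HA Ho]; split; first exact: Hb.
      rewrite /I cats0; split=> //; first exact: bounded_set.
      move=> j; rewrite inE /= /setr; case: eqP => //= _; exact: HG.
    + move=> j lj; have sz := size_flatten_iota F lj.
      rewrite flatten_iotaS size_cat in sz.
      have oB' : size (o ++ flatten [seq F k | k <- iota 0 j]) +
                 size (emit A (setr r i j) c) <= B.
        by rewrite size_cat; move: sz oB; rewrite /F; lia.
      apply: tri_conseq (H _ _ _ _ (fits j lj) oB') => // s [Hb HG HA Ho].
      split; first by rewrite HG ?mem_head // /setr eqxx.
      rewrite /I flatten_iotaS catA; split=> //; first by apply: bounded_set => //; lia.
      move=> k; rewrite inE /= /setr; case: eqP => //= /eqP ki kG.
      by rewrite HG ?inE ?kG ?orbT // /setr (negPf ki).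
  have [s' [Hb HG HA Ho] R] := T s0 Es0; exists s' => //; split=> // j jG.
  by rewrite HG ?inE ?jG ?orbT // /setr ne.
- case/and5P=> okx xG uG wG /andP [vG] /(IH (x :: G)) [|e H]; first by rewrite /= okx.
  have /allP GR := okG.
  exists (80 + e).+1 => B r A o [fB fits] oB.
  apply: (tri_seq (Q := est B (x :: G) (setr r x (r u * r w + r v)) A o)); last first.
    apply: tri_conseq (H B _ A o fits oB) => // s [Hb HG HA Ho]; split=> // j jG.
    rewrite HG ?inE ?jG ?orbT // /setr; case: eqP => // jx; by rewrite -jx jG in xG.
  move=> s [Hb HG HA Ho].
  have /andP [rx xz] := okx.
  have /andP [ru uz] := GR _ uG; have /andP [rw wz] := GR _ wG; have /andP [rv vz] := GR _ vG.
  have ne j : j \in G -> x != j by move=> jG; apply: contraNneq xG => ->.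
  have [|||s' [Hb' [Ea Er Hf] Hx] R] :=
      @tri_mul_add B x u w v s rx ru rw rv _ _ Hb _ s (erefl s).
  + by move: xz; rewrite !inE !negb_or => /andP [-> ->]; rewrite !ne.
  + by move: uz wz vz; rewrite !inE !negb_or /= andbT => -> -> ->.
  + by rewrite !HG.
  exists s' => //; split=> //; rewrite ?Ea ?Er // => j.
  rewrite inE /setr; case: eqP => [-> _|/eqP jx /= jG]; first by rewrite Hx !HG.
  rewrite Hf ?HG // inE (negPf jx) /=; by case/andP: (GR _ jG).
Qed.

(** * Reading the input *)

Lemma setr_setr f d x y : setr (setr f d x) d y = setr f d y.
Proof. by apply: functional_extensionality => j; rewrite /setr; case: eqP. Qed.

Lemma setr_id f d : setr f d (f d) = f.
Proof. by apply: functional_extensionality => j; rewrite /setr; case: eqP => [->|]. Qed.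

(** The final [consume] removes the [false] that terminates a unary number. *)
Definition read_unary r :=
  Seq goto_input (Seq (While isS1 (Seq consume (Seq (store r r) goto_input))) consume).

Definition set_inp (s : state) c x := State (reg s) (arr s) (inp c x).

Lemma exb_goto_unary s c k x B : c <= B ->
  exb goto_input (tp (set_inp s c (unary k ++ x))) home
    (tp (set_inp s c (unary k ++ x))) (Posz c) (2 * B + 2).
Proof. by move=> cB; case: k => [|k]; apply: exb_goto_input. Qed.

Lemma runs_read_unary B s r c n x : is_reg r -> rgt s = inp c (unary n ++ x) ->
  reg s r + n <= B -> c + n <= B ->
  runs B 13 (read_unary r) s (set_inp (set_reg s r (reg s r + n)) (c + n).+1 x).
Proof.
move=> rr sr rB cB.
(* The state in which [k] ones are still unread. *)
pose st k := set_inp (set_reg s r (reg s r + (n - k))) (c + (n - k)) (unary k ++ x).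
pose body := Seq consume (Seq (store r r) goto_input).
have W : exb (While isS1 body) (tp (st n)) (Posz (c + (n - n)))
    (tp (st 0)) (Posz (c + (n - 0))) (n * (2 * cost B).+1).+1.
  apply: (exb_while (F := fun k => tp (st k)) (f := fun k => Posz (c + (n - k)))).
    by rewrite /= /inp subn0 ltnn subnn.
  move=> k lk; split; first by rewrite /= /inp ltnn subnn.
  pose s1 := set_inp (st k.+1) (c + (n - k)) (unary k ++ x).
  have E1 : exb consume (tp (st k.+1)) (Posz (c + (n - k.+1))) (tp s1) home (2 * B + 4).
    rewrite /s1; have -> : c + (n - k) = (c + (n - k.+1)).+1 by lia.
    by apply: exb_consume; lia.
  have E2 : exb (store r r) (tp s1) home (tp (st k)) home (cost B).
    have -> : st k = set_reg s1 r (reg s1 r).+1.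
      rewrite /st /s1 /set_reg /set_inp /= setr_setr /setr eqxx.
      by have -> : reg s r + (n - k) = (reg s r + (n - k.+1)).+1 by lia.
    by apply: exb_inc => //=; rewrite /setr eqxx; lia.
  apply: (exb_seq E1).
    by apply: (exb_seq E2 (exb_goto_unary _ _ _ (B := B) _)); first lia; exact: leqnn.
  rewrite /cost; lia.
have Es : set_inp s c (unary n ++ x) = s by rewrite /set_inp -sr; case: (s).
have Est : st n = s by rewrite /st subnn !addn0 -[RHS]Es /set_reg /set_inp /= setr_id.
rewrite Est subnn addn0 subn0 in W.
have cB' : c <= B by lia.
have := exb_goto_unary s n x cB'; rewrite Es => G.
apply: exb_seq G _ _.
  apply: exb_seq W _ _.
    by rewrite /st subn0; apply: exb_consume cB.
  exact: leqnn.
have -> : (B + 2) ^ 13 = (B + 2) ^ 2 * ((B + 2) ^ 2 * (B + 2) ^ 9) by rewrite -!expnD.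
have := cost_leq B.
have : (B + 2) ^ 2 = B * B + 4 * B + 4 by rewrite expnS expn1; lia.
have : 256 * (B + 1) <= cost B by exact: leqnn.
move: (cost B) ((B + 2) ^ 9) ((B + 2) ^ 2) => x1 x2 x3 h1 h2 h3.
have : n * x1 <= B * x2 by apply: leq_mul; lia.
have : x3 * x2 <= x3 * (x3 * x2) by rewrite leq_pmull; lia.
(* [x2] bounds one register operation, and the square [x3] exceeds [4 * B + 4], enough to pay for at
   most [B] rounds. *)
have : x3 * x2 >= 4 * x2 + 4 * B * x2 by rewrite -mulnDl leq_mul2r; lia.
rewrite mulnS; lia.
Qed.

Definition skip := Act id MN.

Definition read_bit c := Seq goto_input (If isS1 (Seq consume c) (Seq consume skip)).

Lemma runs_skip B e s : runs B e skip s s.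
Proof. by apply: exb_leq (exb_move MN _ _); rewrite expn_gt0; lia. Qed.

Lemma runs_read_bit B e s s' c b x p : rgt s = inp p (b :: x) -> p <= B ->
  runs B e (if b then c else skip) (set_inp s p.+1 x) s' ->
  runs B (e + 10) (read_bit c) s s'.
Proof.
move=> sr pB H.
have -> : s = set_inp s p (b :: x) by rewrite /set_inp -sr; case: (s).
apply: exb_seq (exb_goto_input _ _ _ pB) _ _.
  apply: exb_if.
  have -> : (if isS1 (tp (set_inp s p (b :: x)) p) then Seq consume c else Seq consume skip)
    = Seq consume (if b then c else skip).
    by rewrite /= /inp ltnn subnn; case: (b).
  apply: exb_seq (exb_consume _ _ _ pB) H (leqnn _).
rewrite (addnS e 9); apply: leq_trans (expD_leq _ _ _).
have := cost_leq B; rewrite /cost; lia.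
Qed.

(* Adjacency of the graph obtained by adding a universal vertex [n]. *)
Definition adj_univ n bs u v :=
  if (u < n) && (v < n) then nth false bs (u * n + v) else (u < n) || (v < n).

Definition mat n bs q : nat -> bool :=
  fun p => (p < q) && adj_univ n bs (p %/ n.+1) (p %% n.+1).

Lemma mat_set n bs q : adj_univ n bs (q %/ n.+1) (q %% n.+1) ->
  (fun p => (p == q) || mat n bs q p) = mat n bs q.+1.
Proof.
move=> H; apply: functional_extensionality => p; rewrite /mat ltnS (leq_eqVlt p q).
by case: eqP => [->|_]; [rewrite H|].
Qed.

Lemma mat_skip n bs q : ~~ adj_univ n bs (q %/ n.+1) (q %% n.+1) ->
  mat n bs q = mat n bs q.+1.
Proof.
move=> /negPf H; apply: functional_extensionality => p; rewrite /mat ltnS (leq_eqVlt p q).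
by case: eqP => [->|_]; [rewrite H !andbF|].
Qed.

(** * Building the adjacency matrix with the universal vertex *)

Definition mark_next := Seq (store 11 0) (store 11 11).

(** Register 11 is the write position. Each of the [n] input rows is extended by a one, and a last
    row of [n] ones is appended; the corner entry of the universal vertex with itself stays 0. *)
Definition read_matrix :=
  Seq (for_loop 3 1
        (Seq (for_loop 4 1 (Seq (read_bit (store 11 0)) (store 11 11))) mark_next))
      (for_loop 3 1 mark_next).

Section ReadMatrix.

Variables (B n c0 : nat) (bs rest : seq bool).
Hypotheses (bsn : size bs = n * n) (BB : c0 + n.+1 * n.+1 <= B).

(** [q] counts matrix entries written and [p] input bits read; they drift apart because each row has
    one more entry than its input. *)
Definition rd q p (s : state) :=
  [/\ bounded B s, [/\ reg s 1 = n, reg s 2 = 0, reg s 15 = 0 & reg s 11 = q],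
      arr s = mat n bs q & rgt s = inp (c0 + p) (drop p bs ++ rest)].

Lemma rd_set q p s i x : i \in [:: 3; 4] -> x <= B -> rd q p s -> rd q p (set_reg s i x).
Proof.
move=> iI xB [Hb Hr Ha Hi]; split=> //; first exact: bounded_set.
by move: iI; rewrite !inE => /orP [] /eqP ->.
Qed.

Lemma rd_next q p s : q < B -> rd q p s ->
  adj_univ n bs (q %/ n.+1) (q %% n.+1) ->
  let s' := set_reg (set_arr s q) 11 q.+1 in
  rd q.+1 p s' /\ runs B 19 mark_next s s'.
Proof.
move=> qB [Hb [H1 H2 H15 H11] Ha Hi] adj; split.
  split=> //=; first by apply: (bounded_set (s := set_arr s q)).
  by rewrite Ha mat_set.
have R1 := @runs_set_arr B s 11 isT (Hb _); rewrite H11 in R1.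
have := @runs_inc B (set_arr s q) 11 isT (Hb _); rewrite /= H11 => R2.
exact: runs_seq R1 R2.
Qed.

Lemma rd_read q p s : q < B -> p < n * n -> rd q p s ->
  adj_univ n bs (q %/ n.+1) (q %% n.+1) = nth false bs p ->
  exists2 s', rd q.+1 p.+1 s' /\ (reg s' 3 = reg s 3 /\ reg s' 4 = reg s 4) &
    runs B 29 (Seq (read_bit (store 11 0)) (store 11 11)) s s'.
Proof.
move=> qB pn [Hb [H1 H2 H15 H11] Ha Hi] adj.
have pB : c0 + p <= B by nia.
rewrite (drop_nth false) ?bsn // in Hi.
set b := nth false bs p in adj Hi.
pose s0 := set_inp s (c0 + p).+1 (drop p.+1 bs ++ rest).
pose s1 := if b then set_arr s0 q else s0.
have R0 : runs B 9 (if b then store 11 0 else skip) s0 s1.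
  rewrite /s1; case: (b); last exact: runs_skip.
  by have := @runs_set_arr B s0 11 isT (Hb _); rewrite /= H11.
have R1 := runs_read_bit Hi pB R0.
have E11 : reg s1 11 = q by rewrite /s1; case: (b).
have Er : reg s1 = reg s by rewrite /s1; case: (b).
have R2 := @runs_inc B s1 11 isT; rewrite E11 in R2.
exists (set_reg s1 11 q.+1); last by apply: (runs_seq R1 (R2 _)); lia.
split; last by rewrite /= Er.
split; rewrite /= ?Er //.
- by apply: bounded_set => //; rewrite /bounded Er.
- rewrite /s1; case: (b) adj => adj; rewrite /= Ha; first by rewrite mat_set.
  by rewrite mat_skip // adj.
- by rewrite addnS /s1; case: (b).
Qed.

Lemma divn_row u v : v < n.+1 -> (u * n.+1 + v) %/ n.+1 = u.
Proof. by move=> lv; rewrite divnMDl // divn_small // addn0. Qed.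

Lemma modn_row u v : v < n.+1 -> (u * n.+1 + v) %% n.+1 = v.
Proof. by move=> lv; rewrite modnMDl modn_small. Qed.

Lemma tri_read_matrix : tri B 108 read_matrix (rd 0 0) (rd (n * n.+1 + n) (n * n)).
Proof.
have nB : n <= B by nia.
apply: (@tri_seq B 75 32 _ _ _ (rd (n * n.+1) (n * n))).
  apply: (@tri_conseq B 75 75 _ (rd 0 0) _
    (fun s => rd (n * n.+1) (n * n) s /\ reg s 3 = n)) => //; first by move=> s [].
  apply: (@tri_for B 62 3 1 _ n (fun u s => rd (u * n.+1) (u * n) s /\ reg s 3 = u)) => //.
  - by move=> u s [[_ [-> _ _ _] _ _] ->].
  - move=> s Hs; split; first by case: Hs => Hb _ _ _; apply: Hb.
    by split=> //; apply: rd_set.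
  - move=> u lu.
    pose J v s := [/\ rd (u * n.+1 + v) (u * n + v) s, reg s 3 = u & reg s 4 = v].
    have T1 : tri B 42 (for_loop 4 1 (Seq (read_bit (store 11 0)) (store 11 11)))
        (fun s => rd (u * n.+1) (u * n) s /\ reg s 3 = u) (J n).
      apply: (@tri_for B 29 4 1 _ n J) => //.
      + by move=> v s [[_ [-> _ _ _] _ _] _ ->].
      + move=> s [Hs H3]; split; first by case: Hs => Hb _ _ _; apply: Hb.
        by rewrite /J !addn0; split=> //; apply: rd_set.
      + move=> v lv s [Hs H3 H4].
        have [|||s' [Hs' [E3 E4]] R] := @rd_read (u * n.+1 + v) (u * n + v) s _ _ Hs.
        * by nia.
        * by nia.
        * by rewrite divn_row ?modn_row /adj_univ ?lu ?lv //; lia.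
        exists s' => //; split; first by rewrite E4.
        rewrite /J !addnS; split=> //=; last by rewrite -H3 -E3.
        by apply: rd_set => //; lia.
    have T2 : tri B 19 mark_next (J n)
        (fun s => reg s 3 = u /\
           (rd (u.+1 * n.+1) (u.+1 * n) (set_reg s 3 u.+1) /\ reg (set_reg s 3 u.+1) 3 = u.+1)).
      move=> s [Hs H3 _].
      have [||Hs' R] := rd_next _ Hs; first by nia.
        by rewrite divn_row // modn_row // /adj_univ ltnn andbF lu.
      exists (set_reg (set_arr s (u * n.+1 + n)) 11 (u * n.+1 + n).+1) => //.
      split=> //; split=> //; apply: rd_set => //; first by lia.
      by rewrite !mulSnr addnS.
    by apply: tri_conseq (tri_seq T1 T2).
apply: (@tri_conseq B 32 32 _ (rd (n * n.+1) (n * n)) _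
  (fun s => rd (n * n.+1 + n) (n * n) s /\ reg s 3 = n)) => //; first by move=> s [].
apply: (@tri_for B 19 3 1 _ n (fun v s => rd (n * n.+1 + v) (n * n) s /\ reg s 3 = v)) => //.
- by move=> v s [[_ [-> _ _ _] _ _] ->].
- move=> s Hs; split; first by case: Hs => Hb _ _ _; apply: Hb.
  by rewrite addn0; split=> //; apply: rd_set.
- move=> v lv s [Hs H3].
  have [||Hs' R] := rd_next _ Hs; first by nia.
    by rewrite divn_row ?modn_row /adj_univ ?ltnn ?lv //; lia.
  exists (set_reg (set_arr s (n * n.+1 + v)) 11 (n * n.+1 + v).+1) => //.
  split=> //; rewrite addnS; split=> //; apply: rd_set => //; lia.
Qed.

End ReadMatrix.

(** * Complete programs, from the input tape to the output tape *)

Definition env0 w K : nat -> nat :=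
  fun j => if j == 1 then w else if j == 2 then K else 0.

(** Register 15 serves as the constant 0. *)
Definition scope0 := [:: 1; 2; 15].

Definition mark_home := Act (fun=> S0) MN.

Definition blank_state x := State (fun=> 0) (fun=> false) (inp 0 x).

Lemma exb_mark_home x : exb mark_home (init_tape x) home (tp (blank_state x)) home 1.
Proof.
have -> : tp (blank_state x) = upd (init_tape x) home S0; last exact: exb_write.
apply: functional_extensionality => -[p|[|p]] //=.
  by rewrite /upd /= /inp subn0.
by rewrite /upd /mem_of /= if_same.
Qed.

Lemma tp_output s o : rgt s = outp o ->
  forall i, tp s (iter i right (Posz 1)) = nth SB (map bsym o) i.
Proof.
move=> so i; have -> : iter i right (Posz 1) = Posz i.+1 by elim: i => //= i ->.
by rewrite /tp /= so.
Qed.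

(** The increments after reading turn [n] and [k] into [w] and [K]. The last two moves put the head
    on the first output cell, where [tm_output] starts to read. *)
Definition main_prog c :=
  Seq (Act id ML) (Seq mark_home
    (Seq (Seq (read_unary 1) (Seq read_matrix (Seq (store 1 1) (Seq (read_unary 2) (Seq (store 2 2) (ecomp c))))))
      (moves MR 2))).

Theorem main_prog_correct c : scoped scope0 c ->
  exists e, forall n bs k, size bs = n * n -> forall B,
    let x := unary n ++ bs ++ unary k in
    let A := mat n bs (n * n.+1 + n) in
    let y := emit A (env0 n.+1 k.+1) c in
    efits B (env0 n.+1 k.+1) c ->
    size x + n.+1 * n.+1 + size y <= B ->
    computes_within (tm_of (compile (main_prog c))) x y ((B + 2) ^ e).
Proof.
move=> sc; have okG : all okreg scope0 by [].
have [e He] := tri_ecomp okG sc.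
exists (164 + e) => n bs k bsn B x A y fits hB.
have kB : k.+1 <= B by move: hB; rewrite /x /unary !size_cat !size_nseq /=; lia.
have xB : n.+1 + n * n + k.+1 <= B.
  by move: hB; rewrite /x /unary !size_cat !size_nseq /= bsn; lia.
have sB : n.+1 + n.+1 * n.+1 <= B.
  by move: hB; rewrite /x /unary !size_cat !size_nseq /= bsn; lia.
have R1 : runs B 13 (read_unary 1) (blank_state x)
    (set_inp (set_reg (blank_state x) 1 n) n.+1 (bs ++ unary k)).
  by apply: (@runs_read_unary B (blank_state x) 1 0 n) => //=; lia.
set s1 := set_inp _ _ _ in R1.
have I1 : rd B n n.+1 bs (unary k) 0 0 s1.
  split=> //; last by rewrite addn0 drop0.
  by move=> j; rewrite /= /setr; case: ifP => // _; lia.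
have [s2 [Hb2 [E1 E2 E15 _] Ea Ei] R2] := tri_read_matrix bsn sB I1.
rewrite drop_oversize ?bsn //= -[unary k]cats0 in Ei.
have R3 := @runs_inc B s2 1 isT (Hb2 _); rewrite E1 in R3.
set s3 := set_reg s2 1 n.+1 in R3.
have E3 : reg s3 2 = 0 by [].
have R4 : runs B 13 (read_unary 2) s3 (set_inp (set_reg s3 2 k) (n.+1 + n * n + k).+1 [::]).
  have := @runs_read_unary B s3 2 _ k [::] isT Ei; rewrite E3 add0n; apply; lia.
set s4 := set_inp _ _ _ in R4.
have R5 : runs B 9 (store 2 2) s4 (set_reg s4 2 (reg s4 2).+1).
  by apply: runs_inc; rewrite //= /setr /=; lia.
have E5 : est B scope0 (env0 n.+1 k.+1) A [::] (set_reg s4 2 (reg s4 2).+1).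
  split=> //=; last by rewrite inp_nil.
  - apply: bounded_set => //; apply: (bounded_set (s := s3)); first by lia.
    by apply: bounded_set => //; lia.
  - by move=> j; rewrite !inE => /or3P [] /eqP ->; rewrite /= /setr /= ?E15.
have [|s6 [_ _ _ Eo] R6] := He B (env0 n.+1 k.+1) A [::] fits _ _ E5; first by rewrite add0n -/y; lia.
have R := runs_seq R1 (runs_seq R2 (runs_seq R3 (runs_seq R4 (runs_seq R5 R6)))).
have [t le E] : exb (main_prog c) (init_tape x) 0 (tp s6) (Posz 1) ((B + 2) ^ (164 + e)).
  apply: exb_seq (exb_move _ _ _) _ _.
    apply: exb_seq (exb_mark_home x) _ (leqnn _).
    apply: exb_seq R (exb_moves _ _ _ _) (leqnn _).
  (* The phases sum to an exponent of [157 + e], rounded up to [161 + e]; the factor [(B + 2) ^ 3]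
     pays for the five steps around them. *)
  rewrite (_ : 164 + e = 3 + (161 + e)) // expnD.
  have : (B + 2) ^ (13 + (108 + (9 + (13 + (9 + e).+1).+1).+1).+1).+1 <= (B + 2) ^ (161 + e).
    by apply: exp_leq; lia.
  have : 8 <= (B + 2) ^ 3 by apply: (@leq_trans (2 ^ 3)); rewrite // leq_exp2r //; lia.
  have : 0 < (B + 2) ^ (161 + e) by rewrite expn_gt0; lia.
  move: (_ ^ (161 + e)) (_ ^ 3) (_ ^ (13 + _).+1) => z1 z2 z3 h1 h2 h3; nia.
apply: computes_ex E le _; apply: tp_output Eo.
Qed.

(** For [computable] the argument comes without terminator; an [S0] is written behind it so that
    [read_unary] applies. *)
Definition unary_prog c :=
  Seq (While nonSB (Act id MR)) (Seq (Act (fun=> S0) ML) (Seq (While nonSB (Act id ML))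
    (Seq mark_home (Seq (Seq (read_unary 2) (Seq (store 2 2) (ecomp c))) (moves MR 2))))).

Theorem computable_emit c g : scoped scope0 c ->
  (forall B k, efits B (env0 0 k.+1) c) ->
  (forall k, emit xpred0 (env0 0 k.+1) c = nseq (g k) true) ->
  computable g.
Proof.
move=> sc fits Eg; exists (tm_of (compile (unary_prog c))) => k.
have okG : all okreg scope0 by [].
have [e He] := tri_ecomp okG sc.
pose B := k.+1 + g k; set x := unary k.
pose T0 := init_tape (nseq k true); pose T1 := init_tape x.
have W0 : exb (While nonSB (Act id MR)) T0 (Posz 0) T0 (Posz k) (k * 2).+1.
  rewrite -[in X in exb _ _ X](subnn k) -[in X in exb _ _ _ _ X](subn0 k).
  apply: (exb_while (F := fun=> T0) (f := fun i => Posz (k - i))).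
    by rewrite /T0 /= subn0 nth_default // size_map size_nseq.
  move=> i li; split; first by rewrite /T0 /= map_nseq nth_nseq; have -> : k - i.+1 < k by lia.
  have -> : Posz (k - i) = right (Posz (k - i.+1)) by rewrite /=; congr Posz; lia.
  exact: exb_move.
have E1 : upd T0 (Posz k) S0 = T1.
  apply: functional_extensionality => -[p|p] //; rewrite /upd /T0 /T1 /= /x /unary.
  have -> : (Posz p == Posz k) = (p == k) by [].
  rewrite map_cat nth_cat size_map size_nseq; case: ltngtP => // [lt|->]; last by rewrite subnn.
  by rewrite !nth_default //= ?size_map ?size_nseq; lia.
pose f i := if i is i'.+1 then Posz i' else home.
have Ef i : mv ML (Posz i) = f i by case: i.
have W1 : exb (While nonSB (Act id ML)) T1 (f k) T1 (f 0) (k * 2).+1.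
  apply: (exb_while (F := fun=> T1) (f := f)) => // i li.
  split; last by rewrite -Ef; apply: exb_move.
  rewrite /T1 /= (nth_map false); first by case: (nth _ _ _).
  by rewrite size_cat size_nseq; lia.
have R1 : runs B 13 (read_unary 2) (blank_state x)
    (set_inp (set_reg (blank_state x) 2 k) k.+1 [::]).
  by apply: (@runs_read_unary B (blank_state x) 2 0 k); rewrite /= ?cats0 //; lia.
set s1 := set_inp _ _ _ in R1.
pose s2 := set_reg s1 2 (reg s1 2).+1.
have R2 : runs B 9 (store 2 2) s1 s2.
  by apply: runs_inc; rewrite //= /setr /=; lia.
have E2 : est B scope0 (env0 0 k.+1) xpred0 [::] s2.
  split=> //=; last by rewrite inp_nil.
  - have kB : k.+1 <= B by rewrite /B; lia.
    apply: bounded_set => //; apply: (bounded_set (s := blank_state x)) => //; exact: ltnW.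
  - by move=> j; rewrite !inE => /or3P [] /eqP ->.
have [|s3 [_ _ _ Eo] R3] := He B (env0 0 k.+1) xpred0 [::] (fits _ _) _ _ E2.
  by rewrite Eg size_nseq /B /=; lia.
have R := runs_seq R1 (runs_seq R2 R3); rewrite Eg in Eo.
have [t _ E] : exists2 t, true & ex (unary_prog c) T0 (Posz 0) (tp s3) (Posz 1) t.
  have [t1 _ H1] := W0; have [t2 _ H2] := W1; have [t3 _ H3] := R.
  have [t4 _ H4] := exb_mark_home x; have [t5 _ H5] := exb_moves MR 2 (tp s3) home.
  have H6 := ex_act (fun=> S0) ML T0 (Posz k); rewrite E1 Ef in H6.
  eexists; first by [].
  exact: ex_seq H1 (ex_seq H6 (ex_seq H2 (ex_seq H4 (ex_seq H3 H5)))).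
by exists t; apply: computes_ex E (leqnn _) _; apply: tp_output Eo.
Qed.

(** * The gadget graph *)

(* Vertices carry a tag [t < 7] and indices [(i, u, j, v)]: colours [i, j], vertices [u, v].
   0 = X: selection token of [(i, u)]; 1 = Y: its parking place; 2 = A, 3 = B: start and
   goal of the token of the pair [(i, j)]; 4, 5, 6 = S, P, T: the path from A to B
   through [(u, v)]. Unused indices must be 0; all other vertices are isolated. *)
Definition gcond (A : nat -> bool) (w i u j v : nat) := if i == j then u == v else A (u * w + v).

Definition live A (w t i u j v : nat) :=
  [&& (t <= 1) ==> (j == 0) && (v == 0),
      (1 < t <= 3) ==> (u == 0) && (v == 0) &
      (t == 5) ==> gcond A w i u j v].

(** Each edge is listed in one direction, in the order X-Y, A-S, T-B, S-P or P-T, P-X; [gadj]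
    symmetrizes. *)
Definition link (t i u j v t' i' u' j' v' : nat) :=
  [|| [&& t == 0, t' == 1, i == i' & u == u'],
      [&& t == 2, t' == 4, i == i' & j == j'],
      [&& t == 6, t' == 3, i == i' & j == j'],
      [&& (t == 4) && (t' == 5) || (t == 5) && (t' == 6),
          i == i', u == u', j == j' & v == v'] |
      [&& t == 5, t' == 0 & (i == i') && (u == u') || (j == i') && (v == u')]].

Definition gadj A w t i u j v t' i' u' j' v' :=
  [&& live A w t i u j v, live A w t' i' u' j' v' &
      link t i u j v t' i' u' j' v' || link t' i' u' j' v' t i u j v].

(** Every edge touches a vertex Y, S, P or T, so the vertices X, A and B are pairwise
    non-adjacent. *)
Lemma link_hub t i u j v t' i' u' j' v' : link t i u j v t' i' u' j' v' ->
  [|| t == 4, t == 5, t == 6, t' == 1 | t' == 4].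
Proof.
by case/or4P => [/and4P[_ -> _ _]|/and4P[_ -> _ _]|/and4P[-> _ _ _]|
  /orP[/and5P[/orP[]/andP[-> _] _ _ _ _]|/and3P[-> _ _]]]; rewrite ?orbT.
Qed.

Section Gadget.

Variables (A : nat -> bool) (n k : nat).
Let w := n.+1.
Let K := k.+1.

Definition vtx := ('I_7 * 'I_K * 'I_w * 'I_K * 'I_w)%type.

Definition tg (x : vtx) : 'I_7 := x.1.1.1.1.
Definition ci (x : vtx) : 'I_K := x.1.1.1.2.
Definition cu (x : vtx) : 'I_w := x.1.1.2.
Definition cj (x : vtx) : 'I_K := x.1.2.
Definition cv (x : vtx) : 'I_w := x.2.

Definition vx t i u j v : vtx := (inord t, i, u, j, v).

Lemma vtx_eq (x y : vtx) : tg x = tg y :> nat -> ci x = ci y :> nat -> cu x = cu y :> nat ->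
  cj x = cj y :> nat -> cv x = cv y :> nat -> x = y.
Proof.
case: x y => [[[[t i] u] j] v] [[[[t' i'] u'] j'] v'].
rewrite /tg /ci /cu /cj /cv /= => H1 H2 H3 H4 H5.
by rewrite (val_inj H1) (val_inj H2) (val_inj H3) (val_inj H4) (val_inj H5).
Qed.

Lemma tg_vx t i u j v : t < 7 -> tg (vx t i u j v) = t :> nat.
Proof. by move=> lt; rewrite /tg /= inordK. Qed.

Lemma vxE t i u j v : (ci (vx t i u j v) = i) * (cu (vx t i u j v) = u) *
  (cj (vx t i u j v) = j) * (cv (vx t i u j v) = v).
Proof. by []. Qed.

Definition vlive (x : vtx) := live A w (tg x) (ci x) (cu x) (cj x) (cv x).

Definition vlink (x y : vtx) :=
  link (tg x) (ci x) (cu x) (cj x) (cv x) (tg y) (ci y) (cu y) (cj y) (cv y).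

Definition vadj (x y : vtx) :=
  gadj A w (tg x) (ci x) (cu x) (cj x) (cv x) (tg y) (ci y) (cu y) (cj y) (cv y).

Lemma vadjE x y : vadj x y = [&& vlive x, vlive y & vlink x y || vlink y x].
Proof. by []. Qed.

Lemma vadj_sym x y : vadj x y = vadj y x.
Proof. by rewrite !vadjE orbC; case: (vlive x); case: (vlive y). Qed.

Lemma vadj_irr x : ~~ vadj x x.
Proof.
rewrite vadjE orbb; apply/negP => /and3P [_ _]; rewrite /vlink /link.
by move: (nat_of_ord (tg x)) => t; lia.
Qed.

Notation N := #|{: vtx}|.
Local Notation V := 'I_N.
(** Instances live on ordinals. Numbering by enumeration rank yields the order in which the printing
    loops visit the vertices. *)
Definition pos (x : vtx) : V := enum_rank x.
Definition adj : rel V := fun a b => vadj (enum_val a) (enum_val b).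

Lemma posK x : enum_val (pos x) = x.
Proof. exact: enum_rankK. Qed.

Lemma pos_val a : pos (enum_val a) = a.
Proof. exact: enum_valK. Qed.

Lemma pos_inj : injective pos.
Proof. exact: enum_rank_inj. Qed.

Lemma adj_simple : simple_graph adj.
Proof. by split=> *; [apply: vadj_sym|apply: vadj_irr]. Qed.

Definition bX (q : 'I_K * 'I_w) := vx 0 q.1 q.2 ord0 ord0.
Definition bY (q : 'I_K * 'I_w) := vx 1 q.1 q.2 ord0 ord0.
Definition bA (q : 'I_K * 'I_K) := vx 2 q.1 ord0 q.2 ord0.
Definition bB (q : 'I_K * 'I_K) := vx 3 q.1 ord0 q.2 ord0.

(** * Neighbourhoods and degeneracy *)

Lemma deg2 (X : {set V}) a b c :
  (forall z, vadj (enum_val a) z -> pos z \in X -> z = b \/ z = c) ->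
  #|[set z in X | adj a z]| <= 2.
Proof.
move=> H; apply: (@leq_trans #|[set pos b; pos c]|); last by rewrite cards2; case: eqP.
apply: subset_leq_card; apply/subsetP => z; rewrite !inE => /andP [zX az].
by case: (H (enum_val z) az); rewrite ?pos_val // => <-; rewrite pos_val eqxx ?orbT.
Qed.

Lemma vadj_S x z : tg x = 4 :> nat -> vadj x z ->
  z = vx 2 (ci x) ord0 (cj x) ord0 \/ z = vx 5 (ci x) (cu x) (cj x) (cv x).
Proof.
move=> t; rewrite vadjE /vlive /vlink /live /link t => /and3P [_ Lz L].
have [e|e] : tg z = 2 :> nat \/ tg z = 5 :> nat by move: L; lia.
  by left; apply: vtx_eq; rewrite ?tg_vx ?vxE //; move: Lz L; rewrite e /=; lia.
by right; apply: vtx_eq; rewrite ?tg_vx ?vxE //; move: L; rewrite e /=; lia.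
Qed.

Lemma vadj_T x z : tg x = 6 :> nat -> vadj x z ->
  z = vx 3 (ci x) ord0 (cj x) ord0 \/ z = vx 5 (ci x) (cu x) (cj x) (cv x).
Proof.
move=> t; rewrite vadjE /vlive /vlink /live /link t => /and3P [_ Lz L].
have [e|e] : tg z = 3 :> nat \/ tg z = 5 :> nat by move: L; lia.
  by left; apply: vtx_eq; rewrite ?tg_vx ?vxE //; move: Lz L; rewrite e /=; lia.
by right; apply: vtx_eq; rewrite ?tg_vx ?vxE //; move: L; rewrite e /=; lia.
Qed.

Lemma vadj_Y x z : tg x = 1 :> nat -> vadj x z -> z = bX (ci x, cu x).
Proof.
move=> t; rewrite vadjE /vlive /vlink /live /link t => /and3P [_ Lz L].
have e : tg z = 0 :> nat by move: L; lia.
by apply: vtx_eq; rewrite ?tg_vx ?vxE //; move: Lz L; rewrite e /=; lia.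
Qed.

Lemma vadj_P x z : tg x = 5 :> nat -> vadj x z ->
  [\/ tg z = 4 :> nat, tg z = 6 :> nat, z = bX (ci x, cu x) | z = bX (cj x, cv x)].
Proof.
move=> t; rewrite vadjE /vlive /vlink /live /link t => /and3P [_ Lz L].
have [e|[e|e]] : tg z = 4 :> nat \/ (tg z = 6 :> nat \/ tg z = 0 :> nat) by move: L; lia.
- by constructor 1.
- by constructor 2.
move: Lz L; rewrite e /= ?orbF => Lz /orP [/andP [/eqP e1 /eqP e2]|/andP [/eqP e1 /eqP e2]].
  by constructor 3; apply: vtx_eq; rewrite ?tg_vx ?vxE //=; lia.
by constructor 4; apply: vtx_eq; rewrite ?tg_vx ?vxE //=; lia.
Qed.

Lemma adj_degenerate : two_degenerate adj.
Proof.
move=> X /set0Pn [a0 a0X].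
(* First choice: a vertex Y, S or T, which has at most two neighbours in the whole graph. *)
have [/existsP [a /andP [aX ta]]|/existsPn H1] :=
    boolP [exists a, (a \in X) && (tg (enum_val a) \in [:: inord 1; inord 4; inord 6])].
  exists a => //.
  have : tg (enum_val a) = 1 :> nat \/ (tg (enum_val a) = 4 :> nat \/ tg (enum_val a) = 6 :> nat).
    by move: ta; rewrite !inE => /or3P [] /eqP ->; rewrite inordK //; auto.
  case=> [t|[t|t]].
  - by set x := enum_val a in t; apply: (@deg2 _ _ (bX (ci x, cu x)) (bX (ci x, cu x))) => z /(vadj_Y t); left.
  - by apply: deg2 => z /(vadj_S t) H _; apply: H.
  - by apply: deg2 => z /(vadj_T t) H _; apply: H.
have {}H1 a : a \in X -> [/\ tg (enum_val a) != 1 :> nat, tg (enum_val a) != 4 :> nat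
                           & tg (enum_val a) != 6 :> nat].
  move=> aX; have := H1 a; rewrite aX !inE !negb_or -!val_eqE /= !inordK //.
  by case/and3P.
(* Without S and T, a vertex P keeps only its two selection vertices. *)
have [/existsP [a /andP [aX /eqP ta]]|/existsPn H2] :=
    boolP [exists a, (a \in X) && (tg (enum_val a) == inord 5)].
  have t : tg (enum_val a) = 5 :> nat by rewrite ta inordK.
  exists a => //; set x := enum_val a in t.
  apply: (@deg2 _ _ (bX (ci x, cu x)) (bX (cj x, cv x))) => z /(vadj_P t) H zX.
  have [_ h4 h6] := H1 _ zX; rewrite posK in h4 h6.
  by case: H => H; [rewrite H in h4|rewrite H in h6|left|right].
(* Only X, A and B remain, so there is no edge at all; the two candidate neighbours are dummies. *)
exists a0 => //; apply: (@deg2 _ _ (bX (ord0, ord0)) (bX (ord0, ord0))) => z az zX.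
have ntag t a : t < 7 -> (tg (enum_val a) != inord t) = (tg (enum_val a) != t :> nat).
  by move=> lt; rewrite -val_eqE /= inordK.
have [h1 h4 h6] := H1 _ zX; have := H2 (pos z); rewrite zX /= ntag // posK in h1 h4 h6 * => h5.
have [g1 g4 g6] := H1 _ a0X; have := H2 a0; rewrite a0X /= ntag // => g5.
move: az; rewrite vadjE => /and3P [_ _ /orP [] /link_hub].
  by rewrite (negPf g4) (negPf g5) (negPf g6) (negPf h1) (negPf h4).
by rewrite (negPf h4) (negPf h5) (negPf h6) (negPf g1) (negPf g4).
Qed.

(** * Start and goal configurations *)

Definition config (P : pred vtx) : {set V} := [set a | P (enum_val a)].

Lemma in_config P x : (pos x \in config P) = P x.
Proof. by rewrite inE posK. Qed.

Lemma config_indep (P : pred vtx) :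
  (forall x y, P x -> P y -> ~~ vadj x y) -> independent adj (config P).
Proof.
move=> H; apply/forallP => a; apply/implyP => aP; apply/forallP => b; apply/implyP => bP.
by rewrite !inE in aP bP; apply: H.
Qed.

Definition in_start (x : vtx) := vlive x && ((tg x == 0 :> nat) || (tg x == 2 :> nat)).
Definition in_goal (x : vtx) := vlive x && ((tg x == 0 :> nat) || (tg x == 3 :> nat)).

Definition start := config in_start.
Definition goal := config in_goal.

Lemma live_bX q : vlive (bX q).
Proof. by rewrite /vlive /live tg_vx. Qed.
Lemma live_bY q : vlive (bY q).
Proof. by rewrite /vlive /live tg_vx. Qed.
Lemma live_bA q : vlive (bA q).
Proof. by rewrite /vlive /live tg_vx. Qed.
Lemma live_bB q : vlive (bB q).
Proof. by rewrite /vlive /live tg_vx. Qed.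

Lemma bX_inj : injective bX.
Proof. by move=> [i u] [i' u'] []; move=> -> ->. Qed.
Lemma bA_inj : injective bA.
Proof. by move=> [i u] [i' u'] []; move=> -> ->. Qed.
Lemma bB_inj : injective bB.
Proof. by move=> [i u] [i' u'] []; move=> -> ->. Qed.

Lemma live_X x : vlive x -> tg x = 0 :> nat -> x = bX (ci x, cu x).
Proof.
rewrite /vlive /live => L t; rewrite t /= in L.
by apply: vtx_eq; rewrite ?tg_vx ?vxE //=; lia.
Qed.

Lemma live_Y x : vlive x -> tg x = 1 :> nat -> x = bY (ci x, cu x).
Proof.
rewrite /vlive /live => L t; rewrite t /= in L.
by apply: vtx_eq; rewrite ?tg_vx ?vxE //=; lia.
Qed.

Lemma live_A x : vlive x -> tg x = 2 :> nat -> x = bA (ci x, cj x).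
Proof.
rewrite /vlive /live => L t; rewrite t /= in L.
by apply: vtx_eq; rewrite ?tg_vx ?vxE //=; lia.
Qed.

Lemma live_B x : vlive x -> tg x = 3 :> nat -> x = bB (ci x, cj x).
Proof.
rewrite /vlive /live => L t; rewrite t /= in L.
by apply: vtx_eq; rewrite ?tg_vx ?vxE //=; lia.
Qed.

Definition Xs := [set pos (bX q) | q : 'I_K * 'I_w].
Definition As := [set pos (bA q) | q : 'I_K * 'I_K].
Definition Bs := [set pos (bB q) | q : 'I_K * 'I_K].

Lemma mem_Xs q : pos (bX q) \in Xs.
Proof. exact: (imset_f (fun q => pos (bX q))). Qed.

Lemma mem_Bs q : pos (bB q) \in Bs.
Proof. exact: (imset_f (fun q => pos (bB q))). Qed.

Lemma startE : start = Xs :|: As.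
Proof.
apply/setP => a; rewrite -(pos_val a); set x := enum_val a.
rewrite in_setU in_config; apply/andP/orP.
  case=> L /orP [] /eqP t; [left|right]; apply/imsetP.
    by exists (ci x, cu x); rewrite // -live_X.
  by exists (ci x, cj x); rewrite // -live_A.
case=> /imsetP [q _ /pos_inj ->]; rewrite ?live_bX ?live_bA !tg_vx //.
Qed.

Lemma goalE : goal = Xs :|: Bs.
Proof.
apply/setP => a; rewrite -(pos_val a); set x := enum_val a.
rewrite in_setU in_config; apply/andP/orP.
  case=> L /orP [] /eqP t; [left|right]; apply/imsetP.
    by exists (ci x, cu x); rewrite // -live_X.
  by exists (ci x, cj x); rewrite // -live_B.
case=> /imsetP [q _ /pos_inj ->]; rewrite ?live_bX ?live_bB !tg_vx //.
Qed.

Lemma disj_tags (m1 m2 : nat) (T1 T2 : finType) (f : T1 -> vtx) (g : T2 -> vtx) :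
  (forall q, tg (f q) = m1 :> nat) -> (forall q, tg (g q) = m2 :> nat) -> m1 != m2 ->
  [disjoint [set pos (f q) | q : T1] & [set pos (g q) | q : T2]].
Proof.
move=> H1 H2 ne; rewrite -setI_eq0; apply/eqP/setP => a; rewrite !inE.
apply/negP => /andP [/imsetP [q _ ->] /imsetP [q' _ /pos_inj E]].
by move: ne; rewrite -(H1 q) -(H2 q') E eqxx.
Qed.

Lemma card_start : #|start| = K * w + K * K.
Proof.
rewrite startE cardsU disjoint_setI0 ?cards0 ?subn0; last first.
  by apply: (@disj_tags 0 2) => // q; rewrite tg_vx.
rewrite !card_imset ?card_prod ?card_ord //.
  by apply: inj_comp pos_inj bA_inj.
by apply: inj_comp pos_inj bX_inj.
Qed.

Lemma card_goal : #|goal| = K * w + K * K.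
Proof.
rewrite goalE cardsU disjoint_setI0 ?cards0 ?subn0; last first.
  by apply: (@disj_tags 0 3) => // q; rewrite tg_vx.
rewrite !card_imset ?card_prod ?card_ord //.
  by apply: inj_comp pos_inj bB_inj.
by apply: inj_comp pos_inj bX_inj.
Qed.

Lemma link_tags t i u j v t' i' u' j' v' : link t i u j v t' i' u' j' v' ->
  (t, t') \in [:: (0, 1); (2, 4); (6, 3); (4, 5); (5, 6); (5, 0)].
Proof.
rewrite !inE !xpair_eqE.
by case/or4P => [/and4P[-> -> _ _]|/and4P[-> -> _ _]|/and4P[-> -> _ _]|
  /orP[/and5P[/orP[]/andP[-> ->] _ _ _ _]|/and3P[-> -> _]]]; rewrite ?orbT.
Qed.

Lemma start_indep : independent adj start.
Proof.
apply: config_indep => x y /andP [_ tx] /andP [_ ty]; rewrite vadjE.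
move: tx ty => /orP [] /eqP tx /orP [] /eqP ty.
all: by apply/negP => /and3P [_ _ /orP [] /link_tags]; rewrite tx ty.
Qed.

Lemma goal_indep : independent adj goal.
Proof.
apply: config_indep => x y /andP [_ tx] /andP [_ ty]; rewrite vadjE.
move: tx ty => /orP [] /eqP tx /orP [] /eqP ty.
all: by apply/negP => /and3P [_ _ /orP [] /link_tags]; rewrite tx ty.
Qed.

(** * Accounting for slides by a potential *)

(* Along the path A, S, P, T, B the height grows from 0 to 4; it does not change on
   the moves to and from a selection vertex X. *)
Definition height (a : V) := nth 0 [:: 2; 2; 0; 4; 1; 2; 3] (tg (enum_val a)).

Definition potential (I : {set V}) := \sum_(a in I) height a.

Definition isX (a : V) : nat := tg (enum_val a) == 0 :> nat.

(** An edge at X joins two vertices of height 2, exactly one of them an X; any other edge avoids X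
    and changes the height by 1. So a slide either climbs or touches a selection vertex, never
    both. *)
Lemma height_adj a b : adj a b -> isX a + isX b + height b <= 1 + height a.
Proof.
rewrite /adj vadjE /isX /height => /and3P [_ _ /orP [] /link_tags]; rewrite !inE !xpair_eqE.
  by case/or4P => [||| /or3P[]] /andP [/eqP -> /eqP ->].
by case/or4P => [||| /or3P[]] /andP [/eqP -> /eqP ->].
Qed.

Definition moved (I J : {set V}) (q : 'I_K * 'I_w) : nat :=
  (pos (bX q) \in I) != (pos (bX q) \in J).

Lemma sum_isX a : \sum_q (pos (bX q) == a : nat) <= isX a.
Proof.
have [/existsP [q0 /eqP <-]|/existsPn H] := boolP [exists q, pos (bX q) == a].
  rewrite (bigD1 q0) //= big1 ?addn0 => [|q ne].
    by rewrite eqxx /isX posK tg_vx.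
  by rewrite (inj_eq pos_inj) (inj_eq bX_inj) (negPf ne).
by rewrite big1 // => q _; rewrite (negPf (H q)).
Qed.

Lemma potential_slide I J : slide adj I J ->
  potential J + \sum_q moved I J q <= potential I + 1.
Proof.
case/existsP => a /existsP [b /and4P [aI bI ab /eqP ->]].
rewrite /potential setUC big_setU1 /=; last by rewrite !inE (negPf bI) andbF.
rewrite (big_setD1 a aI) /=.
have : \sum_q moved I (b |: I :\ a) q <= isX a + isX b.
  apply: leq_trans (leq_add (sum_isX a) (sum_isX b)).
  rewrite -big_split leq_sum // => q _ /=; rewrite /moved !inE.
  by case: (eqVneq _ a) => [->|]; case: (eqVneq _ b) => //=; case: (_ \in I).
have := height_adj ab; move: (\sum_q _) (\sum_(i in _) _) (height a) (height b) (isX a) (isX b).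
by move=> *; lia.
Qed.

Fixpoint changes (T : Type) (f : T -> bool) x s : nat :=
  if s is y :: s' then (f x != f y) + changes f y s' else 0.

(** Each slide pays for at most one unit of potential or one change of occupancy of a selection
    vertex. Tokens have no identity here, so switching paths through X brings no advantage. *)
Lemma potential_path I s : path (slide adj) I s ->
  potential (last I s) + \sum_q changes (fun J : {set V} => pos (bX q) \in J) I s
    <= potential I + size s.
Proof.
elim: s I => [|J s IH] I /=; first by rewrite big1.
case/andP=> /potential_slide H /IH; move: H; rewrite big_split /= /moved.
move: (\sum_q changes _ _ _) (\sum_q _) (potential I) (potential J) (potential _) => *; lia.
Qed.

Lemma changes_gt0 (T : eqType) (f : T -> bool) x s y :
  y \in x :: s -> f y != f x -> 0 < changes f x s.
Proof.
elim: s x => [|z s IH] x /=; first by rewrite inE => /eqP ->; rewrite eqxx.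
rewrite inE => /orP [/eqP ->|ys ne]; first by rewrite eqxx.
case: (eqVneq (f x) (f z)) => [e|] //=; rewrite e in ne *; exact: IH ys ne.
Qed.

(** Applied to selection vertices, which are occupied at both ends: one that is ever empty costs two
    slides. *)
Lemma changes_gt1 (T : eqType) (f : T -> bool) x s y :
  y \in x :: s -> f y != f x -> f (last x s) = f x -> 1 < changes f x s.
Proof.
elim: s x => [|z s IH] x /=; first by rewrite inE => /eqP ->; rewrite eqxx.
rewrite inE => /orP [/eqP ->|ys ne]; first by rewrite eqxx.
case: (eqVneq (f x) (f z)) => [e|ne' el] /=.
  by rewrite e in ne * => el; apply: IH ys ne el.
by rewrite ltnS; apply: (@changes_gt0 _ _ _ _ (last z s)); rewrite ?mem_last // el.
Qed.

(** * From a slide sequence to a choice of vertices *)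

Lemma path_crossing (T : eqType) (r : rel T) (R : pred T) x s :
  path r x s -> ~~ R x -> R (last x s) ->
  exists y z, [/\ y \in x :: s, r y z, ~~ R y & R z].
Proof.
elim: s x => [|z s IH] x /= => [_ /negPf ->|/andP [xz H] nR RT] //.
have [Rz|nRz] := boolP (R z); first by exists x, z; rewrite mem_head.
have [y [z' [yin ? ? ?]]] := IH _ H nRz RT.
by exists y, z'; split=> //; rewrite inE yin orbT.
Qed.

Lemma potential_start_goal : potential goal = potential start + 4 * (K * K).
Proof.
have split_sum (B C : {set V}) : [disjoint B & C] ->
    potential (B :|: C) = potential B + potential C.
  by move=> dBC; rewrite /potential -bigU //; apply: eq_bigl => a; rewrite !inE.
rewrite startE goalE !split_sum; last first.
- by apply: (@disj_tags 0 3) => // q; rewrite tg_vx.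
- by apply: (@disj_tags 0 2) => // q; rewrite tg_vx.
have -> : potential As = 0.
  by apply: big1 => a /imsetP [q _ ->]; rewrite /height posK tg_vx.
have -> : potential Bs = #|Bs| * 4.
  rewrite -sum_nat_const; apply: eq_bigr => a /imsetP [q _ ->].
  by rewrite /height posK tg_vx.
rewrite card_imset; last exact: inj_comp pos_inj bB_inj.
by rewrite card_prod card_ord addn0 mulnC.
Qed.

(** [R] says that a token of the pair [(i, j)] is on a T or B vertex. The only way into this region
    from outside is from some P, and while a token is on P, independence keeps both adjacent
    selection vertices empty. *)
Lemma crossing (i j : 'I_K) I J : slide adj I J -> independent adj I ->
  let R (H : {set V}) := [exists a in H, [&& ci (enum_val a) == i, cj (enum_val a) == j &
     (tg (enum_val a) == 3 :> nat) || (tg (enum_val a) == 6 :> nat)]] in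
  ~~ R I -> R J ->
  exists u v : 'I_w, [/\ gcond A w i u j v, pos (bX (i, u)) \notin I & pos (bX (j, v)) \notin I].
Proof.
move=> /existsP [a /existsP [b /and4P [aI bI ab /eqP ->]]] ind R nR.
case/existsP => c /andP [cJ hc].
have {cJ} cb : c = b.
  move: cJ; rewrite !inE => /orP [/andP [_ cI]|/eqP //].
  by case/negP: nR; apply/existsP; exists c; rewrite cI.
rewrite {c}cb in hc; case/and3P: hc => /eqP ei /eqP ej tb.
have {}nR : ~~ [&& ci (enum_val a) == i, cj (enum_val a) == j &
     (tg (enum_val a) == 3 :> nat) || (tg (enum_val a) == 6 :> nat)].
  by apply: contraNN nR => H; apply/existsP; exists a; rewrite aI.
move: ab nR ei ej tb; rewrite /adj; set x := enum_val a; set y := enum_val b.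
rewrite vadjE => /and3P [Lx _ xy] nR ei ej tb.
(* B has only T neighbours of the same pair, and T has B and P; since [x] lies outside the region,
   it must be the P on the path of [y]. *)
have [tx exi eu exj ev] : [/\ tg x = 5 :> nat, ci x = i, cu x = cu y, cj x = j & cv x = cv y].
  rewrite -ei -ej in nR *; clear ei ej.
  have H : [&& tg x == 5 :> nat, ci x == ci y :> nat, cu x == cu y :> nat, cj x == cj y :> nat
     & cv x == cv y :> nat].
    move: xy nR; rewrite -!(inj_eq val_inj) /vlink /link /=.
    by case/orP: tb => /eqP ->; rewrite !andbF /=; lia.
  by case/and5P: H => /eqP -> /eqP /val_inj -> /eqP /val_inj -> /eqP /val_inj -> /eqP /val_inj ->.
exists (cu x), (cv x).
have blocked q : vlink x (bX q) -> pos (bX q) \notin I.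
  move=> lk; apply/negP => qI; move/forallP/(_ a): ind; rewrite aI => /forallP /(_ (pos (bX q))).
  by rewrite qI /adj posK vadjE -/x Lx live_bX lk.
split.
- by move: Lx; rewrite /vlive /live tx exi exj.
- by apply: blocked; rewrite /vlink /link tx tg_vx //= !vxE exi !eqxx.
- by apply: blocked; rewrite /vlink /link tx tg_vx //= !vxE exj !eqxx !orbT.
Qed.

(** The potential consumes [4 * (K * K)] slides, so at most [K] selection vertices are ever empty.
    The pairs [(i, i)] force one for every colour; hence exactly one per colour, and the crossing of
    [(i, j)] uses these. *)
Lemma choice_of_path s : path (slide adj) start s -> last start s = goal ->
  size s <= 4 * (K * K) + 2 * K -> all (independent adj) (start :: s) ->
  exists f : 'I_K -> 'I_w, forall i j, i != j -> A (f i * w + f j).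
Proof.
move=> ps ls ss /allP ind.
pose U := [set q | has (fun J : {set V} => pos (bX q) \notin J) (start :: s)].
have Xstart q : pos (bX q) \in start by rewrite startE in_setU mem_Xs.
have Xgoal q : pos (bX q) \in goal by rewrite goalE in_setU mem_Xs.
have cardU : #|U| <= K.
  have := potential_path ps; rewrite ls potential_start_goal.
  have : \sum_(q in U) 2 <= \sum_q changes (fun J : {set V} => pos (bX q) \in J) start s.
    rewrite [X in _ <= X](bigID (mem U)) /=; apply: leq_trans (leq_addr _ _).
    apply: leq_sum => q; rewrite inE => /hasP [J Js nJ].
    apply: (changes_gt1 Js); last by rewrite ls Xgoal Xstart.
    by rewrite Xstart (negPf nJ).
  by rewrite sum_nat_const; move: (\sum_q _) (potential _) ss => *; lia.
have cross (i j : 'I_K) : exists u v : 'I_w, [/\ gcond A w i u j v, (i, u) \in U & (j, v) \in U].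
  pose R (H : {set V}) := [exists a in H, [&& ci (enum_val a) == i, cj (enum_val a) == j &
     (tg (enum_val a) == 3 :> nat) || (tg (enum_val a) == 6 :> nat)]].
  have nR : ~~ R start.
    apply/negP => /existsP [a /andP []]; rewrite !inE => /andP [_ ta] /and3P [_ _].
    by case/orP: ta => /eqP ->.
  have Rg : R (last start s).
    rewrite ls; apply/existsP; exists (pos (bB (i, j))).
    by rewrite goalE in_setU mem_Bs orbT /= posK tg_vx // !vxE !eqxx.
  have [I [J [Is IJ nRI RJ]]] := path_crossing ps nR Rg.
  have [u [v [g iu jv]]] := crossing IJ (ind _ Is) nRI RJ.
  by exists u, v; split=> //; rewrite inE; apply/hasP; exists I.
(* [U] has at most [K] elements and projects onto all [K] colours, so the projection is injective on
   it. *)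
have injU : {in U &, injective fst}.
  apply/imset_injP; rewrite eqn_leq leq_imset_card /=; apply: leq_trans cardU _.
  have -> : fst @: U = setT.
    apply/setP => i; rewrite inE; apply/imsetP.
    by have [u [v [_ iu _]]] := cross i i; exists (i, u).
  by rewrite cardsT card_ord.
(* Every colour occurs in [U], so the default [ord0] is never taken. *)
exists (fun i => odflt ord0 [pick u | (i, u) \in U]) => i j ij.
have pickE i0 u0 : (i0, u0) \in U -> odflt ord0 [pick u | (i0, u) \in U] = u0.
  move=> H; case: pickP => [u1 H1|/(_ u0)]; last by rewrite H.
  by have [] := injU _ _ H1 H erefl.
have [u [v [g iu jv]]] := cross i j; rewrite (pickE _ _ iu) (pickE _ _ jv).
by move: g; rewrite /gcond -[_ == _ :> nat]/(i == j) (negPf ij).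
Qed.

(** * From a choice of vertices to a slide sequence *)

Definition reach m (I J : {set V}) := exists s,
  [/\ path (slide adj) I s, last I s = J, size s = m & all (independent adj) (I :: s)].

Lemma reach0 I : independent adj I -> reach 0 I I.
Proof. by move=> iI; exists [::]; rewrite /= iI. Qed.

Lemma reach1 I J : independent adj I -> independent adj J -> slide adj I J -> reach 1 I J.
Proof. by move=> iI iJ IJ; exists [:: J]; rewrite /= iI iJ IJ. Qed.

Lemma reach_trans m1 m2 I J H : reach m1 I J -> reach m2 J H -> reach (m1 + m2) I H.
Proof.
move=> [s1 [p1 l1 z1 a1]] [s2 [p2 l2 z2 a2]]; exists (s1 ++ s2).
split; rewrite ?cat_path ?p1 ?last_cat ?l1 ?size_cat ?z1 ?z2 //.
by move: a1 a2; rewrite /= all_cat => /andP [-> ->] /andP [_ ->].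
Qed.

Lemma reach_chain (F : nat -> {set V}) d m : independent adj (F 0) ->
  (forall l, l < m -> reach d (F l) (F l.+1)) -> reach (m * d) (F 0) (F m).
Proof.
move=> i0; elim: m => [|m IH] H; first exact: reach0.
by rewrite mulSnr; apply: reach_trans (IH (fun l lt => H l (leqW lt))) (H m (leqnn _)).
Qed.

Lemma slide_sym I J : slide adj I J -> slide adj J I.
Proof.
case/existsP => a /existsP [b /and4P [aI bI ab /eqP ->]].
have ba : b != a by apply: contraNneq bI => ->.
apply/existsP; exists b; apply/existsP; exists a; rewrite !inE !eqxx orbT /= eq_sym (negPf ba).
rewrite (proj1 adj_simple) ab /=; apply/eqP/setP => c; rewrite !inE.
case: (eqVneq c a) => [->|_]; first by rewrite aI orbT.
by case: (eqVneq c b) => [->|_]; rewrite ?orbF //=; apply: negPf.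
Qed.

(** [reach] records independence only; the number of tokens is recovered from this invariance. *)
Lemma slide_card I J : slide adj I J -> #|J| = #|I|.
Proof.
case/existsP => a /existsP [b /and4P [aI bI _ /eqP ->]].
by rewrite setUC cardsU1 (cardsD1 a I) aI !inE (negPf bI) andbF.
Qed.

Lemma slide_config (P Q : pred vtx) x y : P x -> ~~ P y -> vadj x y ->
  (forall z, Q z = (z == y) || P z && (z != x)) -> slide adj (config P) (config Q).
Proof.
move=> Px Py xy H; apply/existsP; exists (pos x); apply/existsP; exists (pos y).
rewrite !in_config Px Py /adj !posK xy; apply/eqP/setP => a.
by rewrite -(pos_val a) !inE !posK !(inj_eq pos_inj) H orbC andbC.
Qed.

Section Schedule.

Variable f : 'I_K -> 'I_w.
Hypothesis f_clique : forall i j, i != j -> A (f i * w + f j).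

(** [g] is the set of colours whose chosen token is parked on Y; all other selection tokens are on
    X. *)
Definition selection (g : pred 'I_K) (z : vtx) :=
  vlive z && ((tg z == 0 :> nat) && ~~ (g (ci z) && (cu z == f (ci z))) ||
              (tg z == 1 :> nat) && (g (ci z) && (cu z == f (ci z)))).

Definition place i j (m : nat) : vtx :=
  match m with
  | 0 => bA (i, j)
  | 1 => vx 4 i (f i) j (f j)
  | 2 => vx 5 i (f i) j (f j)
  | 3 => vx 6 i (f i) j (f j)
  | _ => bB (i, j)
  end.

(** [h i j] is the number of steps that the token of the pair [(i, j)] has walked along its path. *)
Definition stage (g : pred 'I_K) (h : 'I_K -> 'I_K -> nat) (z : vtx) :=
  selection g z || (z == place (ci z) (cj z) (h (ci z) (cj z))).

Lemma ci_place i j m : ci (place i j m) = i.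
Proof. by case: m => [|[|[|[|m]]]]. Qed.

Lemma cj_place i j m : cj (place i j m) = j.
Proof. by case: m => [|[|[|[|m]]]]. Qed.

Lemma tg_place i j m : tg (place i j m) = nth 3 [:: 2; 4; 5; 6] m :> nat.
Proof. by case: m => [|[|[|[|m]]]]; rewrite tg_vx //= nth_nil. Qed.

Lemma live_place i j m : vlive (place i j m).
Proof.
case: m => [|[|[|[|m]]]]; rewrite ?live_bA ?live_bB // /vlive /live tg_vx //= !vxE /gcond.
by rewrite -[_ == _ :> nat]/(i == j); case: eqVneq => [->|/f_clique ->]; rewrite ?eqxx.
Qed.

Lemma place_not_selection g i j m : ~~ selection g (place i j m).
Proof. by rewrite /selection tg_place; case: m => [|[|[|[|m]]]] /=; rewrite ?nth_nil ?andbF. Qed.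

Lemma place_adj i j m : m < 4 -> vadj (place i j m) (place i j m.+1).
Proof.
move=> lm; rewrite vadjE !live_place /vlink /link !tg_place !ci_place !cj_place !eqxx.
by case: m lm => [|[|[|[|m]]]] //= _; rewrite ?eqxx.
Qed.

(** X and Y of the same index are never both occupied; a walking token meets a selection token only
    at P, where the hypothesis says that both are parked; an edge between walking tokens would join
    a place to itself, since each pair has one token. *)
Lemma stage_indep g h : (forall i j, h i j = 2 -> g i && g j) ->
  independent adj (config (stage g h)).
Proof.
move=> gh; apply: config_indep.
suff H x y : stage g h x -> stage g h y -> vlive x -> vlive y -> ~~ vlink x y.
  move=> x y Sx Sy; apply/negP; rewrite vadjE => /and3P [Lx Ly].
  by rewrite (negPf (H x y Sx Sy Lx Ly)) (negPf (H y x Sy Sx Ly Lx)).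
case/orP => [/andP [_ sx]|/eqP ex] /orP [/andP [_ sy]|/eqP ey] Lx Ly; apply/negP => xy.
- have := link_tags xy; case/orP: sx => /andP [/eqP tx sx]; case/orP: sy => /andP [/eqP ty sy];
    rewrite tx ty // => _.
  move: xy; rewrite /vlink /link tx ty /= !orbF => /andP [/eqP /val_inj e1 /eqP /val_inj e2].
  by move: sx; rewrite e1 e2 sy.
- have := link_tags xy; rewrite ey tg_place; case/orP: sx => /andP [/eqP -> _];
    by case: (h _ _) => [|[|[|[|m]]]] //=; rewrite nth_nil.
- have := link_tags xy; rewrite ex tg_place; case/orP: sy => /andP [/eqP ty sy]; rewrite ty.
    case E: (h _ _) => [|[|[|[|m]]]] //=; rewrite ?nth_nil // => _.
    move: xy ex; rewrite E => xy ex; have /andP [g1 g2] := gh _ _ E.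
    move: xy; rewrite {1}ex /vlink /link tg_place ty /= ex !vxE.
    case/orP => /andP [/eqP /val_inj e1 /eqP /val_inj e2]; move: sy; rewrite -e1 -e2 ?g1 ?g2 eqxx //.
  by case: (h _ _) => [|[|[|[|m]]]] //=; rewrite nth_nil.
- have [e1 e2] : ci x = ci y /\ cj x = cj y.
    have ty : 1 < tg y.
      by rewrite ey tg_place; case: (h _ _) => [|[|[|[|m]]]] //=; rewrite nth_nil.
    have H : (ci x == ci y :> nat) && (cj x == cj y :> nat).
      by move: xy ty; rewrite /vlink /link; lia.
    by case/andP: H => /eqP /val_inj -> /eqP /val_inj ->.
  move: xy; rewrite ex ey e1 e2 => xy; case/negP: (vadj_irr (place (ci y) (cj y) (h (ci y) (cj y)))).
  by rewrite vadjE xy live_place.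
Qed.

Lemma slide_place g h h' i j m : m < 4 -> h i j = m -> h' i j = m.+1 ->
  (forall i' j', (i', j') != (i, j) -> h' i' j' = h i' j') ->
  slide adj (config (stage g h)) (config (stage g h')).
Proof.
move=> lm hm hm' hh; apply: (@slide_config _ _ (place i j m) (place i j m.+1)).
- by rewrite /stage ci_place cj_place hm eqxx orbT.
- rewrite /stage negb_or place_not_selection ci_place cj_place hm andTb.
  apply/eqP => /(congr1 (fun z => tg z : nat)); rewrite !tg_place.
  by case: m lm {hm hm'} => [|[|[|[|m]]]] //=.
- exact: place_adj.
- move=> z; rewrite /stage; case sz: (selection g z); rewrite ?orTb ?orFb.
    have ne i' j' m' : z != place i' j' m'.
      by apply: contraTneq sz => ->; apply: place_not_selection.
    by rewrite (negPf (ne i j m.+1)) (ne i j m).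
  case: (eqVneq (ci z, cj z) (i, j)) => [[-> ->]|ne].
    by rewrite hm hm'; case: (z == place i j m); rewrite ?orbF.
  have ne' m' : z != place i j m'.
    by apply: contraNneq ne => ->; rewrite ci_place cj_place.
  by rewrite hh // (negPf (ne' m.+1)) (ne' m) andbT.
Qed.

Lemma slide_select g g' h i : ~~ g i -> (forall i', g' i' = (i' == i) || g i') ->
  slide adj (config (stage g h)) (config (stage g' h)).
Proof.
move=> gi gg; apply: (@slide_config _ _ (bX (i, f i)) (bY (i, f i))).
- by rewrite /stage /selection live_bX tg_vx //= !vxE (negPf gi).
- rewrite /stage /selection live_bY tg_vx //= !vxE (negPf gi) /=.
  apply/eqP => /(congr1 (fun z => tg z : nat)); rewrite tg_place tg_vx //.
  by case: (h _ _) => [|[|[|[|m]]]] //=; rewrite nth_nil.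
- by rewrite vadjE live_bX live_bY /vlink /link !tg_vx //= !vxE !eqxx.
- move=> z; have eX : (z == bX (i, f i)) = [&& vlive z, tg z == 0 :> nat, ci z == i & cu z == f i].
    apply/eqP/and4P => [->|[L /eqP t /eqP <- /eqP e]]; first by rewrite live_bX tg_vx.
    by rewrite -e; apply: live_X.
  have eY : (z == bY (i, f i)) = [&& vlive z, tg z == 1 :> nat, ci z == i & cu z == f i].
    apply/eqP/and4P => [->|[L /eqP t /eqP <- /eqP e]]; first by rewrite live_bY tg_vx.
    by rewrite -e; apply: live_Y.
  rewrite eX eY /stage /selection gg.
  case: (eqVneq z (place _ _ _)) => [->|_].
    by rewrite tg_place; case: (h _ _) => [|[|[|[|m]]]] //=; rewrite ?nth_nil ?andbF ?orbT.
  case: (vlive z) => //=; case: (eqVneq (ci z) i) => [->|_]; rewrite ?(negPf gi) /=.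
    by case: (cu z == f i); case: (nat_of_ord (tg z)) => [|[|t]].
  by case: (g _); case: (cu z == _); case: (nat_of_ord (tg z)) => [|[|t]].
Qed.

Lemma reach_place (g : pred 'I_K) h h' i j : (forall i', g i') -> h i j = 0 -> h' i j = 4 ->
  (forall i' j', (i', j') != (i, j) -> h' i' j' = h i' j') ->
  reach 4 (config (stage g h)) (config (stage g h')).
Proof.
move=> gT h0 h4 hh.
pose F m i' j' := if (i', j') == (i, j) then m else h i' j'.
(* [h] and [h'] agree with [F 0] and [F 4] only pointwise, so the configurations are compared as
   sets. *)
have ext m (h1 : 'I_K -> 'I_K -> nat) : h1 i j = m ->
    (forall i' j', (i', j') != (i, j) -> h1 i' j' = h i' j') ->
    config (stage g h1) = config (stage g (F m)).
  move=> e1 e2; apply/setP => a; rewrite !inE /stage; congr (_ || (_ == place _ _ _)).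
  by rewrite /F; case: eqVneq => [[-> ->]|/e2].
have ind m : independent adj (config (stage g (F m))) by apply: stage_indep => *; rewrite !gT.
rewrite (ext 0 h) // (ext 4 h') //.
have := @reach_chain (fun m => config (stage g (F m))) 1 4 (ind 0); apply=> l ll.
apply: reach1 => //; apply: (@slide_place _ _ _ i j l) => //; rewrite /F ?eqxx // => i' j'.
by move=> /negPf ->.
Qed.

(** Three phases: park the chosen token of each colour ([K] slides), walk every pair token across in
    enumeration order (4 slides each), and bring the parked tokens back ([K] slides). *)
Lemma reach_start_goal : reach (4 * (K * K) + 2 * K) start goal.
Proof.
pose g m : pred 'I_K := fun i => i < m.
pose h m i j := if enum_rank (i : 'I_K, j : 'I_K) < m then 4 else 0.
pose KK := #|{: 'I_K * 'I_K}|.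
have ind m l : independent adj (config (stage (g m) (h l))).
  by apply: stage_indep => i j; rewrite /h; case: ifP.
have sel l m : m < K -> slide adj (config (stage (g m) (h l))) (config (stage (g m.+1) (h l))).
  move=> lm; apply: (@slide_select _ _ _ (Ordinal lm)); first by rewrite /g ltnn.
  by move=> i; rewrite /g ltnS leq_eqVlt -val_eqE.
have up : reach (K * 1) (config (stage (g 0) (h 0))) (config (stage (g K) (h 0))).
  by apply: (reach_chain (F := fun m => config (stage (g m) (h 0)))) => // m lm; apply: reach1; auto.
have across : reach (KK * 4) (config (stage (g K) (h 0))) (config (stage (g K) (h KK))).
  apply: (reach_chain (F := fun m => config (stage (g K) (h m)))) => // m lm.
  pose q := enum_val (Ordinal lm).
  have rq : enum_rank q = m :> nat by rewrite enum_valK.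
  apply: (@reach_place _ _ _ q.1 q.2); rewrite /h.
  - by move=> i; apply: ltn_ord.
  - by rewrite -surjective_pairing rq ltnn.
  - by rewrite -surjective_pairing rq leqnn.
  - move=> i j ne; rewrite ltnS leq_eqVlt; case: eqP => //= e; case/eqP: ne.
    by rewrite -surjective_pairing; apply: enum_rank_inj; apply: val_inj; rewrite /= e.
(* Parking run backwards, by symmetry of slides. *)
have down : reach (K * 1) (config (stage (g K) (h KK))) (config (stage (g 0) (h KK))).
  have := @reach_chain (fun m => config (stage (g (K - m)) (h KK))) 1 K.
  rewrite subn0 subnn; apply=> // m lm; apply: reach1 => //; apply: slide_sym.
  by rewrite -(subnSK lm); apply: sel; rewrite subnSK // leq_subr.
have startS : start = config (stage (g 0) (h 0)).
  apply/setP => a; rewrite !inE; set z := enum_val a; rewrite /in_start /stage /selection /h ltn0 /=.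
  rewrite !andbF !orbF andbT /in_start andb_orr; congr (_ || _).
  apply/andP/eqP => [[L /eqP t]|->]; first exact: live_A.
  by rewrite live_bA tg_vx.
have goalS : goal = config (stage (g 0) (h KK)).
  apply/setP => a; rewrite !inE; set z := enum_val a; rewrite /in_goal /stage /selection /h ltn_ord /=.
  rewrite !andbF !orbF andbT andb_orr; congr (_ || _).
  apply/andP/eqP => [[L /eqP t]|->]; first exact: live_B.
  by rewrite live_bB tg_vx.
rewrite startS goalS; have := reach_trans up (reach_trans across down).
rewrite /KK card_prod card_ord; congr (reach _ _ _); lia.
Qed.

End Schedule.

(** * The reduced instance *)

Definition gadget_tso := @TSOInst N adj start goal (K * w + K * K) (4 * (K * K) + 2 * K).

Lemma gadget_valid : tso_valid gadget_tso.
Proof.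
split; first exact: adj_simple.
do 4 (split; first by [apply: start_indep|apply: goal_indep|apply: card_start|apply: card_goal]).
by rewrite /=; lia.
Qed.

Lemma gadget_yes : tso_yes gadget_tso <->
  exists f : 'I_K -> 'I_w, forall i j, i != j -> A (f i * w + f j).
Proof.
split=> [[s [ps ls zs /allP alls]]|[f fA]].
  apply: (choice_of_path ps ls zs); apply/allP => I /alls; by case/andP.
have [s [ps ls zs alls]] := reach_start_goal fA; exists s; split=> //=; first by rewrite zs.
have cards (I : {set V}) s' : #|I| = K * w + K * K -> path (slide adj) I s' ->
    all (fun J : {set V} => #|J| == K * w + K * K) (I :: s').
  elim: s' I => [|J s' IH] I /= cI; first by rewrite cI eqxx.
  by case/andP => /slide_card cJ pJ; rewrite {1}cI eqxx; apply: IH; rewrite ?cJ.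
have := cards start s card_start ps.
by move: alls => /allP H1 /allP H2; apply/(@allP _ _ (start :: s)) => I Is; rewrite H1 ?H2.
Qed.

End Gadget.

(** * Printing the instance *)

Definition bimp a b := BOr (BNot a) b.
Definition bzero i := BEq i 15.

Definition bcond i u j v x :=
  BOr (BAnd (BEq i j) (BEq u v)) (BAnd (BNot (BEq i j)) (BLt x 0)).

Definition blive t i u j v x :=
  BAnd (bimp (BConst (t <= 1)) (BAnd (bzero j) (bzero v)))
    (BAnd (bimp (BConst (1 < t <= 3)) (BAnd (bzero u) (bzero v)))
          (bimp (BConst (t == 5)) (bcond i u j v x))).

(** Nested exactly like [link], so that the two agree by computation; tags are program constants
    because the loop over them is unrolled. *)
Definition blink t i u j v t' i' u' j' v' :=
  BOr (BAnd (BConst (t == 0)) (BAnd (BConst (t' == 1)) (BAnd (BEq i i') (BEq u u'))))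
  (BOr (BAnd (BConst (t == 2)) (BAnd (BConst (t' == 4)) (BAnd (BEq i i') (BEq j j'))))
  (BOr (BAnd (BConst (t == 6)) (BAnd (BConst (t' == 3)) (BAnd (BEq i i') (BEq j j'))))
  (BOr (BAnd (BConst ((t == 4) && (t' == 5) || (t == 5) && (t' == 6)))
          (BAnd (BEq i i') (BAnd (BEq u u') (BAnd (BEq j j') (BEq v v')))))
       (BAnd (BConst (t == 5)) (BAnd (BConst (t' == 0))
          (BOr (BAnd (BEq i i') (BEq u u')) (BAnd (BEq j i') (BEq v u')))))))).

Lemma beval_live A r w t i u j v x : r 15 = 0 -> r x = r u * w + r v ->
  beval A r (blive t i u j v x) = live A w t (r i) (r u) (r j) (r v).
Proof.
move=> r0 rx; rewrite /live /gcond /= r0 rx !implybE.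
by case: (r i == r j); rewrite ?orbF.
Qed.

Definition badj t t' :=
  BAnd (blive t 3 4 5 6 11) (BAnd (blive t' 7 8 9 10 12)
    (BOr (blink t 3 4 5 6 t' 7 8 9 10) (blink t' 7 8 9 10 t 3 4 5 6))).

Lemma beval_adj A r w t t' : r 15 = 0 -> r 11 = r 4 * w + r 6 -> r 12 = r 8 * w + r 10 ->
  beval A r (badj t t') =
  gadj A w t (r 3) (r 4) (r 5) (r 6) t' (r 7) (r 8) (r 9) (r 10).
Proof.
move=> r0 r1 r2; rewrite /gadj -(@beval_live A r w t 3 4 5 6 11) //.
by rewrite -(@beval_live A r w t' 7 8 9 10 12).
Qed.

(** * Loops over vertices and the order of enumeration *)

Definition tags (f : nat -> ecmd) := foldr ESeq ENop [seq f t | t <- iota 0 7].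

Definition for_vertices p (body : nat -> ecmd) :=
  tags (fun t => EFor p 2 (EFor p.+1 1 (EFor p.+2 2 (EFor p.+3 1 (body t))))).

Definition set_vertex n k r p (x : vtx n k) :=
  setr (setr (setr (setr r p (ci x)) p.+1 (cu x)) p.+2 (cj x)) p.+3 (cv x).

Lemma flatten_enum_ord (G : nat -> seq bool) m :
  flatten [seq G j | j <- iota 0 m] = flatten [seq G (val a) | a <- enum 'I_m].
Proof. by rewrite -val_enum_ord -map_comp. Qed.

Lemma flatten_enum_prod (T1 T2 : finType) (G : T1 * T2 -> seq bool) :
  flatten [seq G x | x <- enum {: T1 * T2}] =
  flatten [seq flatten [seq G (a, b) | b <- enum T2] | a <- enum T1].
Proof.
have -> : enum {: T1 * T2} = [seq (a, b) | a <- enum T1, b <- enum T2].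
  by rewrite [LHS]enumT unlock.
elim: (enum T1) => //= a s IH.
by rewrite map_cat flatten_cat -IH -map_comp.
Qed.

Lemma emit_tags A r f :
  emit A r (tags f) = flatten [seq emit A r (f t) | t <- iota 0 7].
Proof. by rewrite /tags; elim: (iota 0 7) => //= t s ->. Qed.

(** A product type is enumerated lexicographically, exactly as nested loops run. The shape [q.+3]
    keeps the loop counters away from the bounds in registers 1 and 2. *)
Lemma emit_vertices A n k r q (body : nat -> ecmd) (F : vtx n k -> seq bool) :
  r 1 = n.+1 -> r 2 = k.+1 ->
  (forall x, emit A (set_vertex r q.+3 x) (body (tg x)) = F x) ->
  emit A r (for_vertices q.+3 body) = flatten [seq F x | x <- enum {: vtx n k}].
Proof.
move=> r1 r2 H; have s1 f d x : setr f d.+3 x 1 = f 1 by [].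
have s2 f d x : setr f d.+3 x 2 = f 2 by [].
rewrite emit_tags flatten_enum_ord !flatten_enum_prod.
congr flatten; apply: eq_map => t; rewrite [LHS]/= r2 flatten_enum_ord.
congr flatten; apply: eq_map => i; rewrite s1 r1 flatten_enum_ord.
congr flatten; apply: eq_map => u; rewrite !s2 r2 flatten_enum_ord.
congr flatten; apply: eq_map => j; rewrite !s1 r1 flatten_enum_ord.
by congr flatten; apply: eq_map => v; rewrite -H.
Qed.

Definition emit_adj :=
  for_vertices 3 (fun t => for_vertices 7 (fun t' =>
    EIdx 11 4 1 6 (EIdx 12 8 1 10 (EOut (badj t t'))))).

Definition emit_set (f : nat -> bool) :=
  for_vertices 3 (fun t => EIdx 11 4 1 6 (EOut (BAnd (blive t 3 4 5 6 11) (BConst (f t))))).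

Definition emit_ones2 a b := EFor 3 a (EFor 4 b (EOut (BConst true))).

Definition emit_zero := EOut (BConst false).

Definition emit_length :=
  ESeq (emit_ones2 2 2) (ESeq (emit_ones2 2 2) (ESeq (emit_ones2 2 2) (ESeq (emit_ones2 2 2)
    (ESeq (EFor 3 2 (EOut (BConst true))) (EFor 3 2 (EOut (BConst true))))))).

Definition emit_tso :=
  ESeq (ESeq (ESeq (for_vertices 3 (fun=> EOut (BConst true))) emit_zero) emit_adj)
  (ESeq (emit_set (fun t => (t == 0) || (t == 2)))
  (ESeq (emit_set (fun t => (t == 0) || (t == 3)))
  (ESeq (ESeq (ESeq (emit_ones2 2 1) (emit_ones2 2 2)) emit_zero)
        (ESeq emit_length emit_zero)))).

Lemma scoped_tso : scoped scope0 emit_tso.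
Proof. by []. Qed.

Lemma flatten_ones m c : flatten [seq nseq c true | _ <- iota 0 m] = nseq (m * c) true.
Proof. by elim: m 0 => //= m IH i; rewrite IH mulSn nseqD. Qed.

Lemma emit_ones2E A r a b : (b == 3) = false ->
  emit A r (emit_ones2 a b) = nseq (r a * r b) true.
Proof.
move=> b3; rewrite /= -flatten_ones; congr flatten; apply: eq_map => j.
rewrite /setr b3; have := flatten_ones (r b) 1; rewrite muln1 => <-.
by congr flatten; apply: eq_map.
Qed.

Lemma emit_onesE A r a : emit A r (EFor 3 a (EOut (BConst true))) = nseq (r a) true.
Proof. by rewrite /= -[r a in RHS]muln1 -flatten_ones. Qed.

Lemma emit_lengthE A n k :
  emit A (env0 n k) emit_length = nseq (4 * (k * k) + 2 * k) true.
Proof.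
rewrite /emit_length.
have seqE c1 c2 : emit A (env0 n k) (ESeq c1 c2) =
  emit A (env0 n k) c1 ++ emit A (env0 n k) c2 by [].
rewrite !seqE !emit_ones2E // !emit_onesE -!nseqD; congr nseq.
rewrite /env0 /=; lia.
Qed.

Lemma enum_val_map (T : finType) (S : Type) (F : T -> S) :
  [seq F (enum_val a) | a <- enum 'I_#|T|] = [seq F x | x <- enum T].
Proof.
rewrite [LHS](map_comp F); congr map.
have [x _|T0] := pickP T; last first.
  have E : enum T = [::] by apply: size0nil; rewrite -cardE; apply: eq_card0.
  by rewrite E; apply: size0nil; rewrite size_map -cardE card_ord cardE E.
apply: (@eq_from_nth _ x); first by rewrite size_map -!cardE card_ord.
move=> i; rewrite size_map -cardE card_ord => li.
by rewrite (nth_map (Ordinal li)) -?cardE ?card_ord // (enum_val_nth x) nth_enum_ord.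
Qed.

Lemma emit_adjE A n k :
  emit A (env0 n.+1 k.+1) emit_adj =
  [seq adj A a b | a <- enum 'I_#|{: vtx n k}|, b <- enum 'I_#|{: vtx n k}|].
Proof.
pose F (x : vtx n k) := [seq vadj A x y | y <- enum {: vtx n k}].
rewrite (emit_vertices (F := F)) // => [|x].
  congr flatten; rewrite -[LHS](enum_val_map F); apply: eq_map => a.
  by rewrite -[LHS](enum_val_map (vadj A (enum_val a))).
rewrite (emit_vertices (F := fun y => [:: vadj A x y])) // ?flatten_map1 // => y.
by congr cons; rewrite (@beval_adj _ _ n.+1).
Qed.

Lemma emit_setE A n k (f : nat -> bool) (P : pred (vtx n k)) :
  (forall x, P x = vlive A x && f (tg x)) ->
  emit A (env0 n.+1 k.+1) (emit_set f) = enc_set (config P).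
Proof.
move=> HP; rewrite (emit_vertices (F := fun x : vtx n k => [:: P x])) // => [|x].
  rewrite flatten_map1 -(enum_val_map P) /enc_set; apply: eq_map => a; by rewrite inE.
by congr cons; rewrite HP; congr (_ && _); apply: (@beval_live _ _ n.+1).
Qed.

Lemma emit_ones_vertices A n k :
  emit A (env0 n.+1 k.+1) (for_vertices 3 (fun=> EOut (BConst true))) =
  nseq #|{: vtx n k}| true.
Proof.
rewrite (emit_vertices (F := fun x : vtx n k => [:: true])) //.
by rewrite flatten_map1 cardE; elim: (enum _) => //= x s ->.
Qed.

Lemma emit_tsoE A n k :
  emit A (env0 n.+1 k.+1) emit_tso = enc_tso (gadget_tso A n k).
Proof.
set em := emit A (env0 n.+1 k.+1).
have -> : em emit_tso =
  ((em (for_vertices 3 (fun=> EOut (BConst true))) ++ [:: false]) ++ em emit_adj) ++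
  em (emit_set (fun t => (t == 0) || (t == 2))) ++
  em (emit_set (fun t => (t == 0) || (t == 3))) ++
  ((em (emit_ones2 2 1) ++ em (emit_ones2 2 2)) ++ [:: false]) ++
  em emit_length ++ [:: false] by [].
rewrite {}/em emit_lengthE emit_ones_vertices emit_adjE.
rewrite (emit_setE (P := @in_start A n k)) // (emit_setE (P := @in_goal A n k)) //.
rewrite !emit_ones2E // -nseqD.
by rewrite /enc_tso /enc_graph /unary !catA.
Qed.

(** * Bounds on the computed indices *)

Lemma efits_tags B r f : (forall t, efits B r (f t)) -> efits B r (tags f).
Proof. by rewrite /tags; elim: (iota 0 7) => //= t s IH H; split; auto. Qed.

Lemma efits_vertices B r q body :
  (forall t i u j v, u < r 1 -> v < r 1 ->
     efits B (setr (setr (setr (setr r q.+3 i) q.+4 u) q.+3.+2 j) q.+3.+3 v) (body t)) ->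
  efits B r (for_vertices q.+3 body).
Proof. by move=> H; apply: efits_tags => t i _ u lu j _ v lv; apply: H. Qed.

Lemma efits_tso B n k : n.+1 * n.+1 <= B -> efits B (env0 n.+1 k.+1) emit_tso.
Proof.
move=> nB.
have idx u v : u < n.+1 -> v < n.+1 -> u * n.+1 + v <= B.
  by move=> lu lv; apply: leq_trans nB; nia.
have fset f : efits B (env0 n.+1 k.+1) (emit_set f).
  by apply: efits_vertices => t i u j v lu lv; split=> //; apply: idx.
have fadj : efits B (env0 n.+1 k.+1) emit_adj.
  apply: efits_vertices => t i u j v lu lv; apply: efits_vertices => t' i' u' j' v' lu' lv'.
  by split; [apply: idx|split; first exact: idx].
have fones : efits B (env0 n.+1 k.+1) (for_vertices 3 (fun=> EOut (BConst true))).
  exact: efits_vertices.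
have [flen fkk] : efits B (env0 n.+1 k.+1) emit_length /\
    efits B (env0 n.+1 k.+1) (ESeq (emit_ones2 2 1) (emit_ones2 2 2)) by [].
have seqI c1 c2 : efits B (env0 n.+1 k.+1) c1 -> efits B (env0 n.+1 k.+1) c2 ->
  efits B (env0 n.+1 k.+1) (ESeq c1 c2) by [].
have f0 : efits B (env0 n.+1 k.+1) emit_zero by [].
exact: (seqI _ _ (seqI _ _ (seqI _ _ fones f0) fadj) (seqI _ _ (fset _)
  (seqI _ _ (fset _) (seqI _ _ (seqI _ _ fkk f0) (seqI _ _ flen f0))))).
Qed.

(** * Computability of the parameter functions *)

Lemma computable_succ : computable succn.
Proof.
(* One more [S1] is put in front of the input, and the head stays on it. *)
exists (tm_of (compile (Seq (Act id ML) (Act (fun=> S1) MN)))) => k; exists 2.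
have E := ex_seq (ex_act id ML (init_tape (nseq k true)) 0) (ex_act (fun=> S1) MN _ _).
rewrite upd_same in E; apply: computes_ex E (leqnn _) _ => i.
case: i => [|i]; first by [].
rewrite iterSr; have -> : iter i right (right home) = Posz i by elim: i => //= i ->.
by rewrite /upd /= .
Qed.

(** The command that prints the budget inside the instance computes the parameter bound as well. *)
Lemma computable_length : computable (fun k => 4 * (k.+1 * k.+1) + 2 * k.+1).
Proof. by apply: (@computable_emit emit_length) => // k; apply: emit_lengthE. Qed.

Lemma nth_allpairs (S T R : Type) (x0 : R) (f : S -> T -> R) (s : seq S) (t : seq T) sx tx u v :
  u < size s -> v < size t ->
  nth x0 [seq f x y | x <- s, y <- t] (u * size t + v) = f (nth sx s u) (nth tx t v).
Proof.
move=> + lv; elim: s u => // x s IH [|u] /= lu; rewrite nth_cat size_map.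
  by rewrite lv (nth_map tx).
by rewrite mulSn -addnA ltnNge leq_addr /= addKn IH.
Qed.

(** * Cliques and the universal vertex *)

Section Clique.

Variables (n : nat) (adj : rel 'I_n).
Hypothesis adjP : simple_graph adj.

Definition adj_bits := [seq adj i j | i <- enum 'I_n, j <- enum 'I_n].

Lemma size_adj_bits : size adj_bits = n * n.
Proof. by rewrite size_allpairs -!cardE card_ord. Qed.

Definition univ_mat := mat n adj_bits (n * n.+1 + n).

Lemma univ_matE u v : u <= n -> v <= n -> univ_mat (u * n.+1 + v) = adj_univ n adj_bits u v.
Proof.
move=> un vn; rewrite /univ_mat /mat divn_row // modn_row //.
(* The only index outside the part that is read in is the corner, where both sides are false. *)
case: ltnP => // le; suff [-> ->] : u = n /\ v = n by rewrite /adj_univ ltnn.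
by split; nia.
Qed.

Lemma univ_mat_ord (u v : 'I_n.+1) : univ_mat (u * n.+1 + v) = adj_univ n adj_bits u v.
Proof. by rewrite univ_matE // -ltnS ltn_ord. Qed.

Lemma adj_univ_ord (u v : 'I_n) : adj_univ n adj_bits u v = adj u v.
Proof.
rewrite /adj_univ !ltn_ord /= -[n in u * n](size_enum_ord n).
by rewrite (nth_allpairs _ _ u u) ?size_enum_ord // !nth_ord_enum.
Qed.

Lemma adj_univ_irr u : u <= n -> ~~ adj_univ n adj_bits u u.
Proof.
rewrite leq_eqVlt => /orP [/eqP ->|un]; first by rewrite /adj_univ ltnn.
by rewrite (adj_univ_ord (Ordinal un) (Ordinal un)); case: adjP.
Qed.

(** Forwards, the last colour gets the universal vertex. Backwards, irreflexivity makes [f]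
    injective and one colour is dropped. The added vertex keeps [K] and [w] positive even for
    [k = 0] or [n = 0]. *)
Lemma clique_univ k :
  clique_yes (CliqueInst adj k) <->
  exists f : 'I_k.+1 -> 'I_n.+1, forall i j, i != j -> univ_mat (f i * n.+1 + f j).
Proof.
split=> [[C [/= cC adjC]]|[f fA]].
  pose g (i : 'I_k) : 'I_n := enum_val (cast_ord (esym cC) i).
  exists (fun i => if unlift ord_max i is Some i' then widen_ord (leqnSn n) (g i') else ord_max).
  move=> i j ij; rewrite univ_mat_ord.
  case: unliftP ij => [i' ->|->]; case: unliftP => [j' ->|->] //= ij.
  - rewrite adj_univ_ord; apply: adjC; rewrite ?enum_valP //.
    apply: contraNneq ij => /enum_val_inj /cast_ord_inj ->; exact: eqxx.
  - by rewrite /adj_univ ltnn andbF ltn_ord.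
  - by rewrite /adj_univ ltnn ltn_ord.
  - by rewrite eqxx in ij.
have fA' i j : i != j -> adj_univ n adj_bits (f i) (f j).
  by move/fA; rewrite univ_mat_ord.
have f_inj i j : f i = f j -> i = j.
  move=> fij; apply/eqP; apply: contraT => /fA'; rewrite fij => H.
  by move: (@adj_univ_irr (f j)); rewrite H -ltnS => /(_ (ltn_ord _)).
(* The dropped colour is the one sent to the universal vertex, or an arbitrary one if there is
   none. *)
pose i0 := odflt ord_max [pick i | f i == n :> nat].
have lt i : f (lift i0 i) < n.
  rewrite ltn_neqAle -ltnS ltn_ord andbT; apply/negP => /eqP fi.
  have : f i0 = n :> nat.
    by rewrite /i0; case: pickP => [i1 /eqP //|/(_ (lift i0 i))]; rewrite fi eqxx.
  move=> f0; have /f_inj /eqP : f i0 = f (lift i0 i) by apply: val_inj; rewrite /= f0 fi.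
  by rewrite (negPf (neq_lift _ _)).
pose g i := Ordinal (lt i).
have g_inj : injective g.
  by move=> i j /(congr1 val) /= fij; apply: (@lift_inj _ i0); apply: f_inj; apply: val_inj.
exists [set g i | i : 'I_k]; split; first by rewrite card_imset // card_ord.
move=> u v /imsetP [i _ ->] /imsetP [j _ ->] ne /=.
rewrite -adj_univ_ord; apply: fA'; apply: contraNneq ne => /lift_inj ->; exact: eqxx.
Qed.

End Clique.

(** * Size of the printed instance and conclusion *)

Lemma size_enc_tso A n k : let N := #|{: vtx n k}| in
  size (enc_tso (gadget_tso A n k)) =
  N.+1 + N * N + (N + (N + ((k.+1 * n.+1 + k.+1 * k.+1).+1 +
    (4 * (k.+1 * k.+1) + 2 * k.+1).+1))).
Proof.
rewrite /enc_tso /enc_graph /enc_set /unary !size_cat !size_map !size_nseq size_allpairs.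
by rewrite -!enumT !size_enum_ord !addn1.
Qed.

(** With [q = s + 1] the graph has at most [7 * q ^ 4] vertices, so its matrix has at most
    [49 * q ^ 8] entries. As [q] is at least 3, the factor [q ^ 5] is at least 243 and covers all
    coefficients. *)
Lemma size_tso_bound A n k s : n + k + 2 <= s ->
  s + n.+1 * n.+1 + size (enc_tso (gadget_tso A n k)) + 2 <= s.+1 ^ 13.
Proof.
move=> ns; rewrite size_enc_tso !card_prod !card_ord; set q := s.+1.
have q3 : 3 <= q by lia.
have wq : n.+1 <= q by lia.
have Kq : k.+1 <= q by lia.
have ww : n.+1 * n.+1 <= q * q by apply: leq_mul.
have KK : k.+1 * k.+1 <= q * q by apply: leq_mul.
have Kw : k.+1 * n.+1 <= q * q by apply: leq_mul.
pose P := q * q * (q * q).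
have NP : 7 * k.+1 * n.+1 * k.+1 * n.+1 <= 7 * P.
  by rewrite -!mulnA leq_mul2l /= (mulnA k.+1 n.+1); apply: leq_mul.
move: (7 * k.+1 * n.+1 * k.+1 * n.+1) NP => N NP.
have NN : N * N <= 49 * (P * P).
  by apply: leq_trans (leq_mul NP NP) _; rewrite mulnACA.
have qP : q * q <= P by rewrite /P leq_pmulr //; nia.
have qqq : q <= q * q by nia.
have P1 : 1 <= P by nia.
have PP : P <= P * P by nia.
have -> : q ^ 13 = q ^ 5 * (P * P).
  by rewrite (_ : P = q ^ 4) -?expnD // (expnD q 2 2) /P !mulnn.
have q5 : 243 <= q ^ 5 by apply: (@leq_trans (3 ^ 5)); rewrite // leq_exp2r.
have : 243 * (P * P) <= q ^ 5 * (P * P) by rewrite leq_mul2r q5 orbT.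
have sq : s <= q by exact: leqnSn.
move: ww KK Kw NN NP qP qqq P1 PP Kq sq.
move: (q ^ 5 * _) => z; move: (P * P) (N * N) => PP2 NN2; move: (P) => P2.
move: (q * q) (n.+1 * n.+1) (k.+1 * k.+1) (k.+1 * n.+1) => *.
lia.
Qed.

Lemma computes_within_leq M x y t t' :
  t <= t' -> computes_within M x y t -> computes_within M x y t'.
Proof. by move=> le [i [it H]]; exists i; split=> //; apply: leq_trans le. Qed.

Theorem theorem5p4 : W1_hard_TSO_2degenerate_param_l.
Proof.
have [e He] := main_prog_correct scoped_tso.
(* The reduction is polynomial, so any computable factor that is at least 1 serves for [f]; [succn]
   is one. *)
exists (tm_of (compile (main_prog emit_tso))), succn.
(* [e] is the exponent of the program in terms of [B + 2], and 13 expresses [B + 2] by the input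
   size. *)
exists (fun k => 4 * (k.+1 * k.+1) + 2 * k.+1), (13 * e).
split; first exact: computable_succ.
split; first exact: computable_length.
case=> n adj0 k simp; pose A := univ_mat adj0; pose x := enc_clique (CliqueInst adj0 k).
exists (gadget_tso A n k); split.
- have xE : x = unary n ++ adj_bits adj0 ++ unary k by rewrite catA.
  pose B := size x + n.+1 * n.+1 + size (enc_tso (gadget_tso A n k)).
  have fits : efits B (env0 n.+1 k.+1) emit_tso by apply: efits_tso; rewrite /B; lia.
  have := He n (adj_bits adj0) k (size_adj_bits adj0) B fits.
  rewrite [emit _ _ _]emit_tsoE -xE => /(_ (leqnn _)); apply: computes_within_leq.
  apply: (@leq_trans ((size x).+1 ^ (13 * e))); last exact: leq_pmull.
  rewrite expnM; have [->|e0] := posnP e; first by rewrite !expn0.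
  rewrite leq_exp2r //; apply: size_tso_bound.
  by rewrite xE /unary !size_cat !size_nseq /=; lia.
- exact: gadget_valid.
- exact: adj_degenerate.
- exact: leqnn.
- exact: iff_trans (clique_univ simp k) (iff_sym (gadget_yes A n k)).
Qed.
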